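(* Let $f:\mathbb{R}^2\to\mathbb{R}^2$ be an orientation preserving homeomorphism which satisfies the topological shadowing property. Then $f$ has a fixed point.
   Context: Let $(X,d)$ be a metric space and $f:X\to X$ a homeomorphism. Let $\mathcal{C}^+=\{\epsilon:X\to\mathbb{R}^+ : \epsilon \text{ continuous}\}$ (strictly positive continuous functions). For $\delta\in\mathcal{C}^+$, a sequence $\{x_n\}_{n\in\mathbb{Z}}\subset X$ is a $\delta$-pseudo-orbit of $f$ if $d(f(x_n),x_{n+1})<\delta(f(x_n))$ for every $n\in\mathbb{Z}$. For $\epsilon\in\mathcal{C}^+$, the sequence $\{x_n\}$ is $\epsilon$-shadowed by an orbit if there is $y\in X$ with $d(f^n(y),x_n)<\epsilon(x_n)$ for every $n\in\mathbb{Z}$. The homeomorphism $f$ satisfies the topological shadowing property if for every $\epsilon\in\mathcal{C}^+$ there exists $\delta\in\mathcal{C}^+$ such that every $\delta$-pseudo-orbit is $\epsilon$-shadowed by an orbit. On $\mathbb{R}^d$ the metric is the Euclidean one. *)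

(* Defs.v *)
From Stdlib Require Import Reals ZArith.
Open Scope R_scope.

Definition R2 : Type := (R * R)%type.

Definition dist2 (p q : R2) : R :=
  sqrt ((fst p - fst q) ^ 2 + (snd p - snd q) ^ 2).

Definition norm2 (p : R2) : R := sqrt (fst p ^ 2 + snd p ^ 2).

Definition cont2 (f : R2 -> R2) : Prop :=
  forall x eps, 0 < eps -> exists delta, 0 < delta /\
    forall y, dist2 y x < delta -> dist2 (f y) (f x) < eps.

Definition contR (e : R2 -> R) : Prop :=
  forall x eps, 0 < eps -> exists delta, 0 < delta /\
    forall y, dist2 y x < delta -> Rabs (e y - e x) < eps.

Definition Cplus (e : R2 -> R) : Prop := contR e /\ forall x, 0 < e x.

Definition homeo_with_inv (f g : R2 -> R2) : Prop :=
  cont2 f /\ cont2 g /\ (forall x, g (f x) = x) /\ (forall x, f (g x) = x).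

Definition iterZ (f g : R2 -> R2) (n : Z) (x : R2) : R2 :=
  match n with
  | Z0 => x
  | Zpos p => Nat.iter (Pos.to_nat p) f x
  | Zneg p => Nat.iter (Pos.to_nat p) g x
  end.

Definition pseudo_orbit (f : R2 -> R2) (delta : R2 -> R) (xs : Z -> R2) : Prop :=
  forall n : Z, dist2 (f (xs n)) (xs (n + 1)%Z) < delta (f (xs n)).

Definition shadowed (f g : R2 -> R2) (eps : R2 -> R) (xs : Z -> R2) : Prop :=
  exists y : R2, forall n : Z, dist2 (iterZ f g n y) (xs n) < eps (xs n).

Definition topological_shadowing (f g : R2 -> R2) : Prop :=
  forall eps, Cplus eps -> exists delta, Cplus delta /\
    forall xs, pseudo_orbit f delta xs -> shadowed f g eps xs.

(* Winding number of a loop gamma : [0,1] -> R^2 \ {c} around c equals 1: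
   a continuous angle function theta with gamma t - c = |gamma t - c| (cos theta t, sin theta t)
   on [0,1] increases by exactly 2*PI.  (Lifts are unique up to 2*k*PI, so this is well defined.) *)
Definition winding_one (gamma : R -> R2) (c : R2) : Prop :=
  exists theta : R -> R, continuity theta /\
    (forall t, 0 <= t <= 1 ->
       fst (gamma t) - fst c = norm2 (fst (gamma t) - fst c, snd (gamma t) - snd c) * cos (theta t) /\
       snd (gamma t) - snd c = norm2 (fst (gamma t) - fst c, snd (gamma t) - snd c) * sin (theta t)) /\
    theta 1 - theta 0 = 2 * PI.

Definition circle (x : R2) (r : R) (t : R) : R2 :=
  (fst x + r * cos (2 * PI * t), snd x + r * sin (2 * PI * t)).

(* orientation preserving: f maps every small positively oriented circle about x to a loop of
   winding number (local degree) +1 about f x *)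
Definition orientation_preserving (f : R2 -> R2) : Prop :=
  forall x r, 0 < r -> winding_one (fun t => f (circle x r t)) (f x).

(* Main.v *)
(** Assume that [f] has no fixed point.

    Every vector [f x - x] then has a continuous angle [Theta x] on the whole plane, and
    preservation of orientation gives a continuous rule [Psi] for the angle of [f y - f x] in
    terms of [x], [|y - x|] and the angle of [y - x], which commutes with full turns and with
    the exchange of [x] and [y].  Suppose that a simple arc [c] with [c (t + 1) = f (c t)] can be
    closed up by a path that is disjoint from its image.  Following the angle of the chord from
    [c s] to [c t] and comparing it with [Theta] by means of [Psi] makes the two ends of the
    chord change places, so that an odd multiple of [2 PI] vanishes.

    Such a closed curve exists as soon as some orbit has a cluster point: in the largest disc
    about [z] that is disjoint from its image there are boundary points [a] and [f a], and the
    images of the two radii from [a] to [z] to [f a] form an arc that returns to the disc.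
    Hence all orbits are unbounded in both directions.  (This is Brouwer's lemma.)

    Finally, unbounded orbits contradict shadowing.  Pick [q k] tending to a point [p], and
    [eps] so small at suitable far away points of the orbits that shadowing the forward orbit of
    [q k] forces the shadowing point to be [q k], and shadowing the backward orbit of [p] forces
    it to be [p].  Jumping from [p] to a close [q k] gives a pseudo-orbit that is not shadowed. *)

From Stdlib Require Import Reals ZArith Lra Lia Psatz Classical ClassicalEpsilon.
From Coquelicot Require Import Coquelicot.
Require Import Defs.
Open Scope R_scope.

(** * Continuity on a subset, and plane vectors *)

Lemma continuous_on_comp {U V W : UniformSpace} (D : U -> Prop) (E : V -> Prop)
    (g : U -> V) (f : V -> W) :
  continuous_on D g -> (forall x, D x -> E (g x)) -> continuous_on E f ->
  continuous_on D (fun x => f (g x)).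
Proof.
  intros Hg HDE Hf x Dx.
  apply (filterlim_comp _ _ _ g f _ (within E (locally (g x)))).
  - intros P HP. unfold within, filtermap in *.
    specialize (Hg x Dx _ HP). unfold within, filtermap in Hg.
    revert Hg. apply filter_imp. intros y Hy Dy. apply Hy; auto.
  - apply Hf; auto.
Qed.

Lemma continuous_on_of_continuous {U V : UniformSpace} (D : U -> Prop) (f : U -> V) :
  (forall x, continuous f x) -> continuous_on D f.
Proof. intros H; apply continuous_on_forall; auto. Qed.

Lemma continuous_on_comp_total {U V W : UniformSpace} (D : U -> Prop)
    (g : U -> V) (f : V -> W) :
  continuous_on D g -> (forall x, continuous f x) ->
  continuous_on D (fun x => f (g x)).
Proof.
  intros Hg Hf. apply (continuous_on_comp D (fun _ => True)); auto.
  now apply continuous_on_of_continuous.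
Qed.

Lemma filter_prod_locally {U V : UniformSpace} (x : U) (y : V) (P : U * V -> Prop) :
  locally (x, y) P -> filter_prod (locally x) (locally y) P.
Proof.
  intros [e He].
  exists (ball x e) (ball y e); try apply locally_ball.
  intros a b Ha Hb. apply He. now split.
Qed.

Lemma continuous_on_pair {U V W : UniformSpace} (D : U -> Prop) (f : U -> V) (g : U -> W) :
  continuous_on D f -> continuous_on D g -> continuous_on D (fun x => (f x, g x)).
Proof.
  intros Hf Hg x Dx P HP.
  apply (filterlim_pair f g (Hf x Dx) (Hg x Dx)).
  now apply filter_prod_locally.
Qed.

Lemma continuous_on_id {U : UniformSpace} (D : U -> Prop) : continuous_on D (fun x : U => x).
Proof. apply continuous_on_of_continuous; intros; apply continuous_id. Qed.

Lemma continuous_on_const {U V : UniformSpace} (D : U -> Prop) (v : V) :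
  continuous_on D (fun _ : U => v).
Proof. apply continuous_on_of_continuous; intros; apply continuous_const. Qed.

Lemma continuous_on_fst {U V W : UniformSpace} (D : U -> Prop) (f : U -> V * W) :
  continuous_on D f -> continuous_on D (fun x => fst (f x)).
Proof. intros H. apply (continuous_on_comp_total D f fst); auto. intros [a b]; apply continuous_fst. Qed.

Lemma continuous_on_snd {U V W : UniformSpace} (D : U -> Prop) (f : U -> V * W) :
  continuous_on D f -> continuous_on D (fun x => snd (f x)).
Proof. intros H. apply (continuous_on_comp_total D f snd); auto. intros [a b]; apply continuous_snd. Qed.

Lemma continuous_on_Rplus {U : UniformSpace} (D : U -> Prop) (f g : U -> R) :
  continuous_on D f -> continuous_on D g -> continuous_on D (fun x => f x + g x).
Proof.
  intros Hf Hg x Dx.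
  apply (filterlim_comp_2 _ _ Rplus (Hf x Dx) (Hg x Dx)).
  apply (filterlim_plus (V := R_NormedModule)).
Qed.

Lemma continuous_on_Rmult {U : UniformSpace} (D : U -> Prop) (f g : U -> R) :
  continuous_on D f -> continuous_on D g -> continuous_on D (fun x => f x * g x).
Proof.
  intros Hf Hg x Dx.
  apply (filterlim_comp_2 _ _ Rmult (Hf x Dx) (Hg x Dx)).
  apply (filterlim_mult (K := R_AbsRing)).
Qed.

Lemma continuous_on_Ropp {U : UniformSpace} (D : U -> Prop) (f : U -> R) :
  continuous_on D f -> continuous_on D (fun x => - f x).
Proof.
  intros Hf. apply (continuous_on_comp_total D f Ropp); auto.
  intros x; apply (filterlim_opp (V := R_NormedModule)).
Qed.

Lemma continuous_on_Rminus {U : UniformSpace} (D : U -> Prop) (f g : U -> R) :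
  continuous_on D f -> continuous_on D g -> continuous_on D (fun x => f x - g x).
Proof. intros; apply continuous_on_Rplus; auto; now apply continuous_on_Ropp. Qed.

Lemma continuous_on_cos {U : UniformSpace} (D : U -> Prop) (f : U -> R) :
  continuous_on D f -> continuous_on D (fun x => cos (f x)).
Proof. intros H; apply (continuous_on_comp_total D f cos); auto. apply continuous_cos. Qed.

Lemma continuous_on_sin {U : UniformSpace} (D : U -> Prop) (f : U -> R) :
  continuous_on D f -> continuous_on D (fun x => sin (f x)).
Proof. intros H; apply (continuous_on_comp_total D f sin); auto. apply continuous_sin. Qed.

Definition vadd (u v : R2) : R2 := (fst u + fst v, snd u + snd v).
Definition vsub (u v : R2) : R2 := (fst u - fst v, snd u - snd v).
Definition vscal (k : R) (u : R2) : R2 := (k * fst u, k * snd u).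
Definition dir (t : R) : R2 := (cos t, sin t).

Lemma continuous_on_vadd {U : UniformSpace} (D : U -> Prop) (f g : U -> R2) :
  continuous_on D f -> continuous_on D g -> continuous_on D (fun x => vadd (f x) (g x)).
Proof.
  intros Hf Hg. unfold vadd.
  apply continuous_on_pair; apply continuous_on_Rplus;
    (apply continuous_on_fst || apply continuous_on_snd); assumption.
Qed.

Lemma continuous_on_vsub {U : UniformSpace} (D : U -> Prop) (f g : U -> R2) :
  continuous_on D f -> continuous_on D g -> continuous_on D (fun x => vsub (f x) (g x)).
Proof.
  intros Hf Hg. unfold vsub.
  apply continuous_on_pair; apply continuous_on_Rminus;
    (apply continuous_on_fst || apply continuous_on_snd); assumption.
Qed.

Lemma continuous_on_vscal {U : UniformSpace} (D : U -> Prop) (k : U -> R) (g : U -> R2) :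
  continuous_on D k -> continuous_on D g -> continuous_on D (fun x => vscal (k x) (g x)).
Proof.
  intros Hf Hg. unfold vscal.
  apply continuous_on_pair; apply continuous_on_Rmult; try assumption;
    (apply continuous_on_fst || apply continuous_on_snd); assumption.
Qed.

Lemma continuous_on_dir {U : UniformSpace} (D : U -> Prop) (f : U -> R) :
  continuous_on D f -> continuous_on D (fun x => dir (f x)).
Proof.
  intros H. apply continuous_on_pair; [apply continuous_on_cos | apply continuous_on_sin]; exact H.
Qed.

Lemma continuous_on_norm2 {U : UniformSpace} (D : U -> Prop) (f : U -> R2) :
  continuous_on D f -> continuous_on D (fun x => norm2 (f x)).
Proof.
  intros H. unfold norm2.
  apply (continuous_on_comp_total D (fun x => fst (f x) ^ 2 + snd (f x) ^ 2) sqrt);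
    [|apply continuous_sqrt].
  assert (H1 := continuous_on_fst D f H). assert (H2 := continuous_on_snd D f H).
  apply continuous_on_Rplus; repeat (apply continuous_on_Rmult; try assumption);
    apply continuous_on_const.
Qed.

Lemma norm2_ge0 v : 0 <= norm2 v.
Proof. apply sqrt_pos. Qed.

Lemma norm2_sqr v : norm2 v * norm2 v = fst v * fst v + snd v * snd v.
Proof. unfold norm2. rewrite sqrt_sqrt; nra. Qed.

Lemma norm2_eq0 v : norm2 v = 0 -> v = (0, 0).
Proof.
  intros H. assert (E := norm2_sqr v). rewrite H in E. destruct v as [a b]; simpl in *.
  f_equal; nra.
Qed.

Lemma norm2_gt0 v : v <> (0, 0) -> 0 < norm2 v.
Proof.
  intros H. destruct (norm2_ge0 v) as [|E]; auto.
  elim H; now apply norm2_eq0.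
Qed.

Lemma norm2_unique v n : 0 <= n -> n * n = fst v * fst v + snd v * snd v -> norm2 v = n.
Proof.
  intros Hn E. apply Rsqr_inj; [apply norm2_ge0 | exact Hn |].
  unfold Rsqr. now rewrite norm2_sqr.
Qed.

Lemma norm2_triang u v : norm2 (vadd u v) <= norm2 u + norm2 v.
Proof.
  assert (Eu := norm2_sqr u). assert (Ev := norm2_sqr v). assert (E := norm2_sqr (vadd u v)).
  assert (Pu := norm2_ge0 u). assert (Pv := norm2_ge0 v). assert (P := norm2_ge0 (vadd u v)).
  destruct u as [a b], v as [c d]; unfold vadd in *; cbn [fst snd] in *.
  set (x := norm2 (a, b)) in *; set (y := norm2 (c, d)) in *.
  set (z := norm2 (a + c, b + d)) in *.
  assert (Hcs : a * c + b * d <= x * y).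
  { apply Rsqr_incr_0_var; [|nra]. unfold Rsqr.
    replace (x * y * (x * y)) with ((x * x) * (y * y)) by ring. rewrite Eu, Ev.
    assert (H := Rle_0_sqr (a * d - b * c)). unfold Rsqr in H. nra. }
  apply Rsqr_incr_0_var; [unfold Rsqr|]; nra.
Qed.

Lemma dist2_norm2 p q : dist2 p q = norm2 (vsub p q).
Proof. reflexivity. Qed.

Lemma vsub_eq0 u v : vsub u v = (0, 0) -> u = v.
Proof.
  destruct u as [a b], v as [c d]; unfold vsub; simpl; intros H; inversion H. f_equal; lra.
Qed.

Lemma vsub_neq0 u v : u <> v -> vsub u v <> (0, 0).
Proof. intros H E; apply H; now apply vsub_eq0. Qed.

Lemma norm2_vscal k v : norm2 (vscal k v) = Rabs k * norm2 v.
Proof.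
  apply norm2_unique.
  - apply Rmult_le_pos; [apply Rabs_pos | apply norm2_ge0].
  - assert (E := norm2_sqr v). assert (K : Rabs k * Rabs k = k * k).
    { rewrite <- Rabs_mult. apply Rabs_pos_eq. nra. }
    replace (Rabs k * norm2 v * (Rabs k * norm2 v)) with
      ((Rabs k * Rabs k) * (norm2 v * norm2 v)) by ring.
    rewrite K, E. simpl; ring.
Qed.

Lemma dist2_sym p q : dist2 p q = dist2 q p.
Proof. unfold dist2. f_equal; ring. Qed.

Lemma dist2_refl p : dist2 p p = 0.
Proof. unfold dist2. replace (_ + _) with 0 by ring. apply sqrt_0. Qed.

Lemma dist2_ge0 p q : 0 <= dist2 p q.
Proof. exact (norm2_ge0 (vsub p q)). Qed.

Lemma dist2_eq0 p q : dist2 p q = 0 -> p = q.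
Proof. intros H. apply vsub_eq0, norm2_eq0, H. Qed.

Lemma dist2_triang p q r : dist2 p r <= dist2 p q + dist2 q r.
Proof.
  rewrite !dist2_norm2. replace (vsub p r) with (vadd (vsub p q) (vsub q r)).
  - apply norm2_triang.
  - unfold vadd, vsub; simpl; f_equal; ring.
Qed.

Lemma fst_le_norm2 v : Rabs (fst v) <= norm2 v.
Proof. assert (E := norm2_sqr v). assert (P := norm2_ge0 v). apply Rabs_le; split; nra. Qed.

Lemma snd_le_norm2 v : Rabs (snd v) <= norm2 v.
Proof. assert (E := norm2_sqr v). assert (P := norm2_ge0 v). apply Rabs_le; split; nra. Qed.

Lemma norm2_le_sum v : norm2 v <= Rabs (fst v) + Rabs (snd v).
Proof.
  assert (E := norm2_sqr v). assert (P := norm2_ge0 v).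
  assert (A := Rabs_pos (fst v)). assert (B := Rabs_pos (snd v)).
  assert (A2 : Rabs (fst v) * Rabs (fst v) = fst v * fst v)
    by (rewrite <- Rabs_mult; apply Rabs_pos_eq; nra).
  assert (B2 : Rabs (snd v) * Rabs (snd v) = snd v * snd v)
    by (rewrite <- Rabs_mult; apply Rabs_pos_eq; nra).
  nra.
Qed.

Lemma ball_dist2 (x y : R2) (e : R) : dist2 y x < e -> ball x e y.
Proof.
  intros H. assert (A := fst_le_norm2 (vsub y x)). assert (B := snd_le_norm2 (vsub y x)).
  rewrite dist2_norm2 in H. unfold vsub in A, B; simpl in A, B.
  split; unfold ball; simpl; unfold AbsRing_ball, abs, minus, plus, opp; simpl;
    (eapply Rle_lt_trans; [eassumption | exact H]).
Qed.

(** Balls of the product space are squares; half the radius suffices because the norm is at most the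
    sum of the absolute values of the coordinates. *)
Lemma dist2_ball (x y : R2) (e : R) : ball x (e / 2) y -> dist2 y x < e.
Proof.
  intros [A B]. unfold ball in A, B; simpl in A, B.
  unfold AbsRing_ball, abs, minus, plus, opp in A, B; simpl in A, B.
  rewrite dist2_norm2. eapply Rle_lt_trans; [apply norm2_le_sum|].
  unfold vsub; cbn [fst snd]. unfold Rminus. lra.
Qed.

Lemma cont2_continuous (f : R2 -> R2) : cont2 f -> forall x, continuous f x.
Proof.
  intros Hf x P [e He]. destruct (Hf x e (cond_pos e)) as [d [Hd Hdf]].
  assert (Hd2 : 0 < d / 2) by lra.
  exists (mkposreal _ Hd2). intros y Hy. apply He, ball_dist2, Hdf, dist2_ball, Hy.
Qed.

(** * Angles and turning *)

(** Every number is an angle of the zero vector, so uniqueness modulo [2 * PI] is only available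
    away from it. *)
Definition isangle (v : R2) (t : R) : Prop :=
  fst v = norm2 v * cos t /\ snd v = norm2 v * sin t.

Definition in2piZ (x : R) : Prop := exists k : Z, x = 2 * PI * IZR k.

Definition dot (u v : R2) : R := fst u * fst v + snd u * snd v.
Definition cross (u v : R2) : R := fst u * snd v - snd u * fst v.
(** The signed angle from [u] to [v], in the range of [atan]. It has this meaning only when
    [0 < dot u v], that is, when the vectors are less than a quarter turn apart. *)
Definition arg (u v : R2) : R := atan (cross u v / dot u v).

Lemma isangle_vscal v t : isangle v t -> v = vscal (norm2 v) (dir t).
Proof. intros [A B]. destruct v; unfold vscal, dir; simpl in *. now f_equal. Qed.

Lemma cos_eq_1_in2piZ x : cos x = 1 -> in2piZ x.
Proof.
  intros H. replace x with (2 * (x / 2)) in H by field. rewrite cos_2a_sin in H.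
  assert (S : sin (x / 2) = 0) by nra.
  destruct (sin_eq_0_0 _ S) as [k Hk]. exists k. lra.
Qed.

Lemma isangle_unique v a b : v <> (0, 0) -> isangle v a -> isangle v b -> in2piZ (a - b).
Proof.
  intros Hv [A1 A2] [B1 B2]. apply cos_eq_1_in2piZ. rewrite cos_minus.
  assert (P := norm2_gt0 v Hv). rewrite A1 in B1. rewrite A2 in B2.
  apply Rmult_eq_reg_l in B1; [|lra]. apply Rmult_eq_reg_l in B2; [|lra].
  rewrite <- B1, <- B2. assert (E := sin2_cos2 a). unfold Rsqr in E. lra.
Qed.

Lemma norm2_opp v : norm2 (vscal (-1) v) = norm2 v.
Proof. rewrite norm2_vscal, Rabs_left; lra. Qed.

Lemma isangle_opp v t : isangle v t -> isangle (vscal (-1) v) (t + PI).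
Proof.
  intros [A B]. unfold isangle. rewrite norm2_opp, neg_cos, neg_sin.
  unfold vscal; cbn [fst snd]. rewrite A at 1; rewrite B at 1. split; ring.
Qed.

(** By Lagrange's identity for [dot] and [cross], [arg u v] has cosine
    [dot u v / (norm2 u * norm2 v)] and sine [cross u v / (norm2 u * norm2 v)]; the addition
    formulas then carry the direction of [u] to that of [v]. *)
Lemma isangle_arg u v t : 0 < dot u v -> isangle u t -> isangle v (t + arg u v).
Proof.
  intros Hd [A B].
  assert (Eu := norm2_sqr u). assert (Ev := norm2_sqr v).
  assert (Pu := norm2_ge0 u). assert (Pv := norm2_ge0 v).
  assert (Hu : 0 < norm2 u).
  { destruct Pu as [|E]; auto. rewrite <- E in A, B. unfold dot in Hd. rewrite A, B in Hd. lra. }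
  assert (Hv : 0 < norm2 v).
  { destruct Pv as [|E]; auto. rewrite <- E in Ev. unfold dot in Hd.
    assert (fst v = 0) by nra. assert (snd v = 0) by nra. rewrite H, H0 in Hd. lra. }
  set (q := cross u v / dot u v).
  assert (Hs : sqrt (1 + q²) = norm2 u * norm2 v / dot u v).
  { apply sqrt_lem_1.
    - assert (H := Rle_0_sqr q); lra.
    - apply Rlt_le, Rdiv_lt_0_compat; auto. now apply Rmult_lt_0_compat.
    - unfold q, Rsqr.
      replace (norm2 u * norm2 v / dot u v * (norm2 u * norm2 v / dot u v))
        with ((norm2 u * norm2 u) * (norm2 v * norm2 v) / (dot u v * dot u v)) by (field; lra).
      rewrite Eu, Ev. unfold cross, dot in *. field. lra. }
  assert (C : cos (arg u v) = dot u v / (norm2 u * norm2 v)).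
  { unfold arg; fold q. rewrite cos_atan, Hs. field. repeat split; lra. }
  assert (S : sin (arg u v) = cross u v / (norm2 u * norm2 v)).
  { unfold arg; fold q. rewrite sin_atan, Hs. unfold q. field. repeat split; lra. }
  unfold isangle. rewrite cos_plus, sin_plus, C, S.
  assert (A' : cos t = fst u / norm2 u) by (rewrite A at 1; field; lra).
  assert (B' : sin t = snd u / norm2 u) by (rewrite B at 1; field; lra).
  rewrite A', B'. unfold dot, cross.
  split; apply Rmult_eq_reg_l with (norm2 u * norm2 u); try nra.
  - replace (norm2 u * norm2 u * (norm2 v *
      (fst u / norm2 u * ((fst u * fst v + snd u * snd v) / (norm2 u * norm2 v)) -
       snd u / norm2 u * ((fst u * snd v - snd u * fst v) / (norm2 u * norm2 v)))))
     with ((fst u * fst u + snd u * snd u) * fst v) by (field; lra).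
    now rewrite Eu.
  - replace (norm2 u * norm2 u * (norm2 v *
      (snd u / norm2 u * ((fst u * fst v + snd u * snd v) / (norm2 u * norm2 v)) +
       fst u / norm2 u * ((fst u * snd v - snd u * fst v) / (norm2 u * norm2 v)))))
     with ((fst u * fst u + snd u * snd u) * snd v) by (field; lra).
    now rewrite Eu.
Qed.

Lemma isangle_exists v : v <> (0, 0) -> exists t, isangle v t.
Proof.
  intros Hv.
  assert (N : forall c s, c * c + s * s = 1 -> norm2 (c, s) = 1).
  { intros c s E. apply norm2_unique; simpl; lra. }
  (* One of the four unit vectors on the axes has positive scalar product with [v]; [arg] is
     measured from it. *)
  assert (H : exists u t, isangle u t /\ 0 < dot u v).
  { destruct (Rtotal_order (fst v) 0) as [L|[E|G]].
    - exists (-1, 0), PI. unfold isangle, dot. rewrite N, cos_PI, sin_PI by ring.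
      simpl; repeat split; lra.
    - destruct (Rtotal_order (snd v) 0) as [L'|[E'|G']].
      + exists (0, -1), (- (PI / 2)). unfold isangle, dot.
        rewrite N, cos_neg, sin_neg, cos_PI2, sin_PI2 by ring. simpl; repeat split; lra.
      + elim Hv. destruct v; simpl in *; now f_equal.
      + exists (0, 1), (PI / 2). unfold isangle, dot.
        rewrite N, cos_PI2, sin_PI2 by ring. simpl; repeat split; lra.
    - exists (1, 0), 0. unfold isangle, dot. rewrite N, cos_0, sin_0 by ring.
      simpl; repeat split; lra. }
  destruct H as [u [t [Hu Hd]]]. exists (t + arg u v). now apply isangle_arg.
Qed.

Lemma in2piZ_small x : in2piZ x -> Rabs x < 2 * PI -> x = 0.
Proof.
  intros [k E] H. assert (P := PI_RGT_0).
  assert (k = 0)%Z as ->; [|lra].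
  assert (-1 < k < 1)%Z; [|lia].
  apply Rabs_def2 in H. split; apply lt_IZR; nra.
Qed.

Lemma arg_bound u v : - PI / 2 < arg u v < PI / 2.
Proof. apply atan_bound. Qed.

Lemma dot_pos_neq0 u v : 0 < dot u v -> u <> (0, 0) /\ v <> (0, 0).
Proof. intros H; split; intros ->; unfold dot in H; simpl in H; lra. Qed.

(** Both sides are angles from [u] to [w], hence differ by a multiple of [2 * PI]; three angles
    below a quarter turn leave a difference below [3 * PI / 2]. *)
Lemma arg_chain u v w : 0 < dot u v -> 0 < dot v w -> 0 < dot u w ->
  arg u v + arg v w = arg u w.
Proof.
  intros H1 H2 H3.
  destruct (isangle_exists u) as [t Ht]; [apply (dot_pos_neq0 u v H1)|].
  assert (A := isangle_arg u w t H3 Ht).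
  assert (B := isangle_arg v w _ H2 (isangle_arg u v t H1 Ht)).
  assert (U := isangle_unique w _ _ (proj2 (dot_pos_neq0 v w H2)) B A).
  apply in2piZ_small in U; [lra|].
  assert (b1 := arg_bound u v). assert (b2 := arg_bound v w). assert (b3 := arg_bound u w).
  apply Rabs_def1; lra.
Qed.

Lemma continuous_on_arg {U : UniformSpace} (D : U -> Prop) (f g : U -> R2) :
  continuous_on D f -> continuous_on D g -> (forall x, D x -> 0 < dot (f x) (g x)) ->
  continuous_on D (fun x => arg (f x) (g x)).
Proof.
  intros Hf Hg Hd. unfold arg.
  assert (f1 := continuous_on_fst D f Hf). assert (f2 := continuous_on_snd D f Hf).
  assert (g1 := continuous_on_fst D g Hg). assert (g2 := continuous_on_snd D g Hg).
  apply (continuous_on_comp_total D (fun x => cross (f x) (g x) / dot (f x) (g x)) atan);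
    [|apply continuous_atan].
  apply continuous_on_Rmult.
  - apply continuous_on_Rminus; apply continuous_on_Rmult; assumption.
  - apply (continuous_on_comp D (fun y => y <> 0) (fun x => dot (f x) (g x)) Rinv).
    + apply continuous_on_Rplus; apply continuous_on_Rmult; assumption.
    + intros x Dx. specialize (Hd x Dx). lra.
    + apply continuous_on_forall. intros; now apply continuous_Rinv.
Qed.

(** The sum of the angles between consecutive points of [G] over [2 ^ k] equal pieces of [[a, b]];
    on a [fine] path it is the net change of the angle. *)
Fixpoint turning (k : nat) (G : R -> R2) (a b : R) : R :=
  match k with
  | O => arg (G a) (G b)
  | S k => turning k G a ((a + b) / 2) + turning k G ((a + b) / 2) b
  end.

(** All pairs of parameters within one dyadic step are considered, not only neighbouring grid
    points, so that the property survives refinement. *)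
Definition fine (k : nat) (G : R -> R2) (a b : R) : Prop :=
  forall t t', a <= t <= b -> a <= t' <= b -> Rabs (t - t') <= (b - a) / 2 ^ k ->
    0 < dot (G t) (G t').

Lemma fine_halves k G a b : a <= b -> fine (S k) G a b ->
  fine k G a ((a + b) / 2) /\ fine k G ((a + b) / 2) b.
Proof.
  intros Hab H.
  assert (P : 2 ^ k <> 0) by (apply pow_nonzero; lra).
  split; intros t t' Ht Ht' E; apply H; try lra; simpl;
    (replace ((b - a) / (2 * 2 ^ k)) with ((b - a) / 2 / 2 ^ k) by (field; exact P)).
  - replace ((b - a) / 2) with ((a + b) / 2 - a) by field; exact E.
  - replace ((b - a) / 2) with (b - (a + b) / 2) by field; exact E.
Qed.

Lemma fine_S k G a b : a <= b -> fine k G a b -> fine (S k) G a b.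
Proof.
  intros Hab H t t' Ht Ht' E. apply H; auto. apply Rle_trans with (1 := E).
  apply Rmult_le_compat_l; [lra|]. apply Rinv_le_contravar; [apply pow_lt; lra|].
  simpl. assert (0 < 2 ^ k) by (apply pow_lt; lra). lra.
Qed.

(** One more halving splits each small angle in two, and [arg_chain] adds the two halves up
    again. *)
Lemma turning_S k : forall G a b, a <= b -> fine k G a b ->
  turning (S k) G a b = turning k G a b.
Proof.
  induction k as [|k IH]; intros G a b Hab H.
  - simpl. apply arg_chain; apply H; simpl; try lra;
      rewrite <- Rabs_Ropp, Rabs_pos_eq; lra.
  - destruct (fine_halves k G a b Hab H) as [Hl Hr].
    change (turning (S (S k)) G a b) with
      (turning (S k) G a ((a + b) / 2) + turning (S k) G ((a + b) / 2) b).
    rewrite (IH G a), (IH G _ b); auto; lra.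
Qed.

Lemma turning_indep k j G a b : a <= b -> fine k G a b ->
  fine (j + k) G a b /\ turning (j + k) G a b = turning k G a b.
Proof.
  intros Hab H. induction j as [|j [IH1 IH2]]; auto. split.
  - now apply fine_S.
  - rewrite <- IH2. now apply (turning_S (j + k)).
Qed.

Lemma turning_unique k k' G a b : a <= b -> fine k G a b -> fine k' G a b ->
  turning k G a b = turning k' G a b.
Proof.
  intros Hab H H'.
  rewrite <- (proj2 (turning_indep k k' G a b Hab H)).
  rewrite <- (proj2 (turning_indep k' k G a b Hab H')).
  now rewrite Nat.add_comm.
Qed.

Lemma isangle_turning k : forall G a b t, a <= b -> fine k G a b ->
  isangle (G a) t -> isangle (G b) (t + turning k G a b).
Proof.
  induction k as [|k IH]; intros G a b t Hab H Ht.
  - simpl. apply isangle_arg; auto. apply H; simpl; try lra.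
    rewrite <- Rabs_Ropp, Rabs_pos_eq; lra.
  - destruct (fine_halves k G a b Hab H) as [Hl Hr]. simpl.
    rewrite <- Rplus_assoc. apply IH; auto; try lra. apply IH; auto; lra.
Qed.

Lemma continuous_on_turning {U : UniformSpace} (D : U -> Prop) (G : U -> R -> R2) k :
  forall a b, a <= b ->
  (forall t, a <= t <= b -> continuous_on D (fun x => G x t)) ->
  (forall x, D x -> fine k (G x) a b) ->
  continuous_on D (fun x => turning k (G x) a b).
Proof.
  induction k as [|k IH]; intros a b Hab HG Hf.
  - simpl. apply continuous_on_arg; try (apply HG; lra).
    intros x Dx. apply (Hf x Dx); simpl; try lra.
    rewrite <- Rabs_Ropp, Rabs_pos_eq; lra.
  - simpl. apply continuous_on_Rplus; apply IH; try lra.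
    + intros; apply HG; lra.
    + intros x Dx. apply (fine_halves k (G x) a b Hab (Hf x Dx)).
    + intros; apply HG; lra.
    + intros x Dx. apply (fine_halves k (G x) a b Hab (Hf x Dx)).
Qed.

(** Half of the Cauchy-Schwarz inequality, obtained by squaring the reverse triangle inequality for
    [vadd u v]. *)
Lemma dot_ge u v : - (norm2 u * norm2 v) <= dot u v.
Proof.
  assert (Eu := norm2_sqr u). assert (Ev := norm2_sqr v). assert (T := norm2_triang u v).
  assert (E := norm2_sqr (vadd u v)).
  assert (Pu := norm2_ge0 u). assert (Pv := norm2_ge0 v).
  assert (H := norm2_triang (vadd u v) (vscal (-1) v)). rewrite norm2_opp in H.
  assert (H' := norm2_triang (vadd u v) (vscal (-1) u)). rewrite norm2_opp in H'.
  replace (vadd (vadd u v) (vscal (-1) v)) with u in H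
    by (destruct u, v; unfold vadd, vscal; simpl; f_equal; ring).
  replace (vadd (vadd u v) (vscal (-1) u)) with v in H'
    by (destruct u, v; unfold vadd, vscal; simpl; f_equal; ring).
  assert (P := norm2_ge0 (vadd u v)).
  unfold dot. unfold vadd at 3 4 5 6 in E; cbn [fst snd] in E.
  assert ((norm2 u - norm2 v) * (norm2 u - norm2 v) <= norm2 (vadd u v) * norm2 (vadd u v)) by nra.
  nra.
Qed.

(** With [p = u + d] and [q = u + e], the error terms amount to at most [1/4 + 1/4 + 1/16] of
    [dot u u]. *)
Lemma dot_pos_near u p q : u <> (0, 0) ->
  dist2 p u < norm2 u / 4 -> dist2 q u < norm2 u / 4 -> 0 < dot p q.
Proof.
  intros Hu Hp Hq. apply norm2_gt0 in Hu. rewrite dist2_norm2 in Hp, Hq.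
  set (d := vsub p u) in *. set (e := vsub q u) in *.
  assert (E : dot p q = dot u u + dot u e + dot d u + dot d e).
  { unfold dot, d, e, vsub; simpl; ring. }
  assert (E0 : dot u u = norm2 u * norm2 u) by (rewrite norm2_sqr; reflexivity).
  assert (A := dot_ge u e). assert (B := dot_ge d u). assert (C := dot_ge d e).
  assert (Pd := norm2_ge0 d). assert (Pe := norm2_ge0 e).
  set (x := norm2 u) in *; set (y := norm2 d) in *; set (z := norm2 e) in *.
  assert (x * z <= x * (x / 4)) by (apply Rmult_le_compat_l; lra).
  assert (y * x <= (x / 4) * x) by (apply Rmult_le_compat_r; lra).
  assert (y * z <= (x / 4) * (x / 4)) by (apply Rmult_le_compat; lra).
  nra.
Qed.

(** * Continuous angles on convex sets and their comparison *)

Definition seg {V : NormedModule R_AbsRing} (x y : V) (t : R) : V :=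
  plus x (scal t (minus y x)).

Definition convex_set {V : NormedModule R_AbsRing} (D : V -> Prop) : Prop :=
  forall x y t, D x -> D y -> 0 <= t <= 1 -> D (seg x y t).

Lemma seg_0 {V : NormedModule R_AbsRing} (x y : V) : seg x y 0 = x.
Proof. unfold seg. rewrite (scal_zero_l (K := R_AbsRing)). apply plus_zero_r. Qed.

Lemma seg_1 {V : NormedModule R_AbsRing} (x y : V) : seg x y 1 = y.
Proof.
  unfold seg. rewrite (scal_one (K := R_AbsRing)). unfold minus.
  rewrite (plus_comm y), plus_assoc, (@plus_opp_r (NormedModule.AbelianGroup R_AbsRing V)).
  apply plus_zero_l.
Qed.

Lemma continuous_seg {V : NormedModule R_AbsRing} (x : V) (p : R * V) :
  continuous (fun p : R * V => seg x (snd p) (fst p)) p.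
Proof.
  unfold seg. apply (continuous_plus (fun _ => x)); [apply continuous_const|].
  apply (continuous_scal (fun p : R * V => fst p) (fun p : R * V => minus (snd p) x)).
  - destruct p; apply continuous_fst.
  - apply (continuous_minus (fun p : R * V => snd p)); [|apply continuous_const].
    destruct p; apply continuous_snd.
Qed.

(** Near [x] the sets [D] and [E] agree, so continuity on [E] is enough. This serves a function that
    is given by a single formula only on [E]. *)
Lemma continuous_on_within {U V : UniformSpace} (D E : U -> Prop) (f : U -> V) x :
  D x -> (forall y, E y -> D y) -> locally x (fun y => D y -> E y) -> continuous_on E f ->
  filterlim f (within D (locally x)) (locally (f x)).
Proof.
  intros Dx HED HDE Hf P HP.
  assert (Ex : E x) by (apply (locally_singleton _ _ HDE); exact Dx).
  specialize (Hf x Ex P HP). unfold filtermap, within in *.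
  generalize (filter_and _ _ HDE Hf). apply filter_imp. intuition.
Qed.

(** A Lebesgue number argument: the segment from [x0] to [x] is compact and [F] has no zero on it,
    so one order of subdivision works for it and for the segments from [x0] to all points of [D]
    near [x]. *)
Lemma fine_tube {V : NormedModule R_AbsRing} (D : V -> Prop) (F : V -> R2) (x0 x : V) :
  convex_set D -> continuous_on D F -> (forall y, D y -> F y <> (0, 0)) ->
  D x0 -> D x ->
  exists k, locally x (fun y => D y -> fine k (fun t => F (seg x0 y t)) 0 1).
Proof.
  intros HD HF HF0 D0 Dx.
  assert (Hloc : forall t0, exists d : posreal, 0 <= t0 <= 1 ->
    forall t y, D y -> 0 <= t <= 1 -> Rabs (t - t0) < 2 * d -> ball x d y ->
      dist2 (F (seg x0 y t)) (F (seg x0 x t0)) < norm2 (F (seg x0 x t0)) / 4).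
  { intros t0. destruct (classic (0 <= t0 <= 1)) as [Ht0|]; [|now exists (mkposreal 1 Rlt_0_1)].
    assert (Ds := HD _ _ _ D0 Dx Ht0).
    assert (Hn := norm2_gt0 _ (HF0 _ Ds)).
    set (n := norm2 (F (seg x0 x t0))) in *.
    assert (Hn8 : 0 < n / 4 / 2) by lra.
    assert (H := HF _ Ds _ (locally_ball _ (mkposreal _ Hn8))).
    destruct (continuous_seg x0 (t0, x) _ H) as [e He].
    assert (He2 : 0 < e / 2) by (assert (Q := cond_pos e); lra).
    exists (mkposreal _ He2). intros _ t y Dy Ht Hd Hb. simpl in Hd.
    apply dist2_ball. apply (He (t, y)); [|now apply HD].
    split; simpl.
    - unfold ball; simpl; unfold AbsRing_ball, abs, minus, plus, opp; simpl.
      unfold Rminus in Hd. lra.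
    - apply (ball_le _ (e / 2)); [|exact Hb]. assert (Q := cond_pos e). lra. }
  apply choice in Hloc. destruct Hloc as [delta Hdelta].
  destruct (compactness_value_1d 0 1 delta) as [d Hd].
  destruct (pow_lt_1_zero (/ 2)) with (y := pos d) as [k Hk].
  { rewrite Rabs_pos_eq; lra. } { apply cond_pos. }
  exists k, d. intros y Hy Dy t t' Ht Ht' Htt.
  apply NNPP. intros Hneg. apply (Hd t Ht). intros [t0 [Ht0 [Htt0 Hdd]]]. apply Hneg.
  assert (Dq := cond_pos d).
  assert (Hxy : ball x (delta t0) y) by (apply (ball_le x d); auto).
  specialize (Hk k (Nat.le_refl k)). rewrite pow_inv in Hk.
  rewrite Rabs_pos_eq in Hk by (apply Rlt_le, Rinv_0_lt_compat, pow_lt; lra).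
  assert (Htt' : Rabs (t - t') < d) by (unfold Rdiv in Htt; lra).
  apply (dot_pos_near (F (seg x0 x t0))).
  - apply HF0. now apply HD.
  - apply Hdelta; auto. lra.
  - apply Hdelta; auto. replace (t' - t0) with ((t - t0) - (t - t')) by ring.
    eapply Rle_lt_trans; [apply Rabs_triang|]. rewrite Rabs_Ropp. lra.
Qed.

(** The angle at [x] is a fixed angle at a base point [x0] plus the turning of [F] along the segment
    from [x0] to [x]. *)
Lemma angle_lift {V : NormedModule R_AbsRing} (D : V -> Prop) (F : V -> R2) :
  convex_set D -> continuous_on D F -> (forall y, D y -> F y <> (0, 0)) ->
  exists L : V -> R, continuous_on D L /\ forall x, D x -> isangle (F x) (L x).
Proof.
  intros HD HF HF0.
  destruct (classic (exists x0, D x0)) as [[x0 D0]|Hempty].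
  2:{ exists (fun _ => 0); split; intros x Dx; elim Hempty; now exists x. }
  destruct (isangle_exists _ (HF0 _ D0)) as [phi Hphi].
  set (G := fun y t => F (seg x0 y t)).
  assert (HK : forall x, exists k, D x -> fine k (G x) 0 1).
  { intros x. destruct (classic (D x)) as [Dx|]; [|now exists O].
    destruct (fine_tube D F x0 x HD HF HF0 D0 Dx) as [k Hk].
    exists k. apply (locally_singleton _ _ Hk). }
  apply choice in HK. destruct HK as [K HK].
  exists (fun x => phi + turning (K x) (G x) 0 1). split.
  - intros x Dx.
    destruct (fine_tube D F x0 x HD HF HF0 D0 Dx) as [k Hk].
    set (E := fun y => D y /\ fine k (G y) 0 1).
    apply (continuous_on_within D E (fun x => phi + turning (K x) (G x) 0 1) x); auto.
    + now intros y [].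
    + revert Hk; apply filter_imp; intros y Hy Dy; split; auto.
    (* The chosen order [K x] may jump from point to point, but the turning does not depend on it;
       near [x] the single order [k] serves. *)
    + apply (continuous_on_ext E (fun x => phi + turning k (G x) 0 1)).
      { intros y [Dy Hy]. f_equal. apply turning_unique; auto. lra. }
      apply continuous_on_Rplus; [apply continuous_on_const|].
      apply continuous_on_turning; [lra| |now intros y []].
      intros t Ht. apply (continuous_on_comp E D (fun y => seg x0 y t) F); auto.
      * apply continuous_on_of_continuous. intros y.
        apply (continuous_comp (fun y => (t, y)) (fun p : R * V => seg x0 (snd p) (fst p))).
        -- intros P [e He]. exists e. intros z Hz. apply He. split; [apply ball_center | exact Hz].
        -- apply continuous_seg.
      * intros y [Dy _]. now apply HD.
  - intros x Dx.
    replace (F x) with (G x 1) by (unfold G; now rewrite seg_1).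
    apply isangle_turning; [lra | auto |].
    unfold G. now rewrite seg_0.
Qed.

(** It extends paths on [[0, 1]] to the whole line, as the intermediate value theorem requires, and
    later gives the profile of [ramp]. *)
Definition clamp (t : R) : R := Rmax 0 (Rmin 1 t).

Lemma clamp_range t : 0 <= clamp t <= 1.
Proof. unfold clamp, Rmax, Rmin. repeat destruct Rle_dec; lra. Qed.

Lemma clamp_id t : 0 <= t <= 1 -> clamp t = t.
Proof. unfold clamp, Rmax, Rmin. repeat destruct Rle_dec; lra. Qed.

Lemma continuous_clamp t : continuous clamp t.
Proof.
  intros P [e He]. exists e. intros y Hy. apply He.
  unfold ball in *; simpl in *; unfold AbsRing_ball, abs, minus, plus, opp in *; simpl in *.
  eapply Rle_lt_trans; [|exact Hy].
  unfold clamp, Rmax, Rmin, Rabs. repeat destruct Rle_dec; repeat destruct Rcase_abs; lra.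
Qed.

(** Along a segment, two different values would force an intermediate value at an odd multiple of
    [PI]. *)
Lemma in2piZ_continuous_const {V : NormedModule R_AbsRing} (D : V -> Prop) (h : V -> R) :
  convex_set D -> continuous_on D h -> (forall x, D x -> in2piZ (h x)) ->
  forall x y, D x -> D y -> h x = h y.
Proof.
  intros HD Hh Hz x y Dx Dy.
  set (u := fun t => h (seg x y (clamp t))).
  assert (Du : forall t, D (seg x y (clamp t))) by (intros; apply HD; auto; apply clamp_range).
  assert (Hu : forall t, continuous u t).
  { intros t.
    assert (C : continuous_on (fun _ : R => True) u).
    { apply (continuous_on_comp _ D (fun t => seg x y (clamp t)) h); auto.
      apply continuous_on_of_continuous. intros s.
      apply (continuous_comp (fun s => (clamp s, y)) (fun p : R * V => seg x (snd p) (fst p))).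
      - intros P [e He]. destruct (continuous_clamp s _ (locally_ball _ e)) as [d Hd].
        exists d. intros z Hzz. apply He. split; [now apply Hd | apply ball_center].
      - apply continuous_seg. }
    apply (continuous_continuous_on (fun _ : R => True)); auto.
    now exists (mkposreal 1 Rlt_0_1). }
  assert (E0 : u 0 = h x) by (unfold u; rewrite clamp_id, seg_0; auto; lra).
  assert (E1 : u 1 = h y) by (unfold u; rewrite clamp_id, seg_1; auto; lra).
  destruct (Hz x Dx) as [k Hk]. destruct (Hz y Dy) as [l Hl].
  assert (P := PI_RGT_0).
  assert (Hno : forall v m, v = 2 * PI * IZR m + PI ->
    Rmin (u 0) (u 1) <= v <= Rmax (u 0) (u 1) -> False).
  { intros v m Hv Hb. destruct (IVT_gen_consistent u 0 1 v Hu Hb) as [t [_ Ht]].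
    destruct (Hz _ (Du t)) as [j Hj]. unfold u in Ht. rewrite Hj, Hv in Ht.
    assert (IZR (2 * j) = IZR (2 * m + 1)) as Q.
    { rewrite plus_IZR, !mult_IZR. apply Rmult_eq_reg_l with PI; lra. }
    apply eq_IZR in Q. lia. }
  destruct (Z.lt_trichotomy k l) as [H|[H|H]].
  - exfalso. assert (Q : IZR k + 1 <= IZR l) by (rewrite <- plus_IZR; apply IZR_le; lia).
    apply (Hno (h x + PI) k); [lra|]. rewrite E0, E1.
    rewrite Rmin_left, Rmax_right by nra. nra.
  - subst l. lra.
  - exfalso. assert (Q : IZR l + 1 <= IZR k) by (rewrite <- plus_IZR; apply IZR_le; lia).
    apply (Hno (h y + PI) l); [lra|]. rewrite E0, E1.
    rewrite Rmin_right, Rmax_left by nra. nra.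
Qed.

(** Meant for two continuous angles of one nonvanishing vector field; the integer obtained is the
    bookkeeping device of the arguments below. *)
Lemma lift_diff_const {V : NormedModule R_AbsRing} (D : V -> Prop) (L M : V -> R) :
  convex_set D -> continuous_on D L -> continuous_on D M ->
  (forall x, D x -> in2piZ (L x - M x)) ->
  exists k : Z, forall x, D x -> L x = M x + 2 * PI * IZR k.
Proof.
  intros HD HL HM Hz.
  destruct (classic (exists x0, D x0)) as [[x0 D0]|Hempty].
  2:{ exists 0%Z; intros x Dx; elim Hempty; now exists x. }
  destruct (Hz x0 D0) as [k Hk]. exists k. intros x Dx.
  assert (E := in2piZ_continuous_const D (fun x => L x - M x) HD
    (continuous_on_Rminus D L M HL HM) Hz x x0 Dx D0). simpl in E. lra.
Qed.

(** * Action of a homeomorphism on angles *)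

Ltac cts :=
  repeat first
    [ assumption
    | lazymatch goal with
      | |- continuous_on _ (fun _ => ?v) => apply continuous_on_const
      | |- continuous_on _ (fun x => x) => apply continuous_on_id
      | |- continuous_on _ (fun x => vadd (@?a x) (@?b x)) => apply (continuous_on_vadd _ a b)
      | |- continuous_on _ (fun x => vsub (@?a x) (@?b x)) => apply (continuous_on_vsub _ a b)
      | |- continuous_on _ (fun x => vscal (@?a x) (@?b x)) => apply (continuous_on_vscal _ a b)
      | |- continuous_on _ (fun x => dir (@?a x)) => apply (continuous_on_dir _ a)
      | |- continuous_on _ (fun x => norm2 (@?a x)) => apply (continuous_on_norm2 _ a)
      | |- continuous_on _ (fun x => (@?a x, @?b x)) => apply (continuous_on_pair _ a b)
      | |- continuous_on _ (pair ?a) => apply (continuous_on_pair _ (fun _ => a) (fun x => x))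
      | |- continuous_on _ fst => apply (continuous_on_fst _ (fun x => x))
      | |- continuous_on _ snd => apply (continuous_on_snd _ (fun x => x))
      | |- continuous_on _ (fun x => fst (@?a x)) => apply (continuous_on_fst _ a)
      | |- continuous_on _ (fun x => snd (@?a x)) => apply (continuous_on_snd _ a)
      | |- continuous_on _ (fun x => @?a x + @?b x) => apply (continuous_on_Rplus _ a b)
      | |- continuous_on _ (fun x => @?a x - @?b x) => apply (continuous_on_Rminus _ a b)
      | |- continuous_on _ (fun x => @?a x * @?b x) => apply (continuous_on_Rmult _ a b)
      end ].

Ltac convex := intros ? ? ? ? ? ?;
  repeat match goal with x : prod _ _ |- _ => destruct x end;
  unfold seg, minus, plus, scal, opp in *; simpl in *;
  unfold prod_plus, prod_scal, prod_opp, mult in *; simpl in *;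
  unfold scal, plus, opp, mult in *; simpl in *;
  unfold prod_plus, prod_scal, prod_opp, mult in *; simpl in *.

(* The product of the [UniformSpace] structures is convertible, but not syntactically equal, to
   the one underlying the product of [NormedModule] structures; the four lemmas below restate the
   lifting lemmas for the former. *)
Definition planeNM : NormedModule R_AbsRing :=
  prod_NormedModule R_AbsRing R_NormedModule R_NormedModule.

Definition spaceNM : NormedModule R_AbsRing := prod_NormedModule R_AbsRing planeNM planeNM.

Lemma angle_lift_plane (D : R * R -> Prop) (F : R * R -> R2) :
  convex_set (V := planeNM) D -> continuous_on D F -> (forall y, D y -> F y <> (0, 0)) ->
  exists L : R * R -> R, continuous_on D L /\ forall x, D x -> isangle (F x) (L x).
Proof. exact (angle_lift (V := planeNM) D F). Qed.

Lemma lift_diff_const_plane (D : R * R -> Prop) (L M : R * R -> R) :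
  convex_set (V := planeNM) D -> continuous_on D L -> continuous_on D M ->
  (forall x, D x -> in2piZ (L x - M x)) ->
  exists k : Z, forall x, D x -> L x = M x + 2 * PI * IZR k.
Proof. exact (lift_diff_const (V := planeNM) D L M). Qed.

Lemma angle_lift_space (D : R2 * (R * R) -> Prop) (F : R2 * (R * R) -> R2) :
  convex_set (V := spaceNM) D -> continuous_on D F -> (forall y, D y -> F y <> (0, 0)) ->
  exists L : R2 * (R * R) -> R, continuous_on D L /\ forall x, D x -> isangle (F x) (L x).
Proof. exact (angle_lift (V := spaceNM) D F). Qed.

Lemma lift_diff_const_space (D : R2 * (R * R) -> Prop) (L M : R2 * (R * R) -> R) :
  convex_set (V := spaceNM) D -> continuous_on D L -> continuous_on D M ->
  (forall x, D x -> in2piZ (L x - M x)) ->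
  exists k : Z, forall x, D x -> L x = M x + 2 * PI * IZR k.
Proof. exact (lift_diff_const (V := spaceNM) D L M). Qed.

Lemma convex_lt a b a' b' t : a < a' -> b < b' -> 0 <= t <= 1 ->
  a + t * (b + - a) < a' + t * (b' + - a').
Proof.
  intros Ha Hb Ht.
  assert (A : 0 <= (1 - t) * (a' - a)) by (apply Rmult_le_pos; lra).
  assert (B : 0 <= t * (b' - b)) by (apply Rmult_le_pos; lra).
  destruct (Rle_lt_dec t (1 / 2)).
  - assert (0 < (1 - t) * (a' - a)) by (apply Rmult_lt_0_compat; lra). lra.
  - assert (0 < t * (b' - b)) by (apply Rmult_lt_0_compat; lra). lra.
Qed.

Lemma convex_le a b a' b' t : a <= a' -> b <= b' -> 0 <= t <= 1 ->
  a + t * (b + - a) <= a' + t * (b' + - a').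
Proof.
  intros Ha Hb Ht.
  assert (A : 0 <= (1 - t) * (a' - a)) by (apply Rmult_le_pos; lra).
  assert (B : 0 <= t * (b' - b)) by (apply Rmult_le_pos; lra).
  lra.
Qed.

Lemma convex_gtc c a b t : c < a -> c < b -> 0 <= t <= 1 -> c < a + t * (b + - a).
Proof. intros Ha Hb Ht. assert (H := convex_lt c c a b t Ha Hb Ht). lra. Qed.

Lemma convex_ltc c a b t : a < c -> b < c -> 0 <= t <= 1 -> a + t * (b + - a) < c.
Proof. intros Ha Hb Ht. assert (H := convex_lt a b c c t Ha Hb Ht). lra. Qed.

Lemma convex_gec c a b t : c <= a -> c <= b -> 0 <= t <= 1 -> c <= a + t * (b + - a).
Proof. intros Ha Hb Ht. assert (H := convex_le c c a b t Ha Hb Ht). lra. Qed.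

Lemma convex_lec c a b t : a <= c -> b <= c -> 0 <= t <= 1 -> a + t * (b + - a) <= c.
Proof. intros Ha Hb Ht. assert (H := convex_le a b c c t Ha Hb Ht). lra. Qed.

Ltac convex_bounds :=
  repeat split;
  first [apply convex_gtc | apply convex_ltc | apply convex_gec | apply convex_lec
        | apply convex_lt | apply convex_le];
  first [assumption | apply Rlt_le; assumption | tauto | lra].

(** The second point is given by the length [r] and the unreduced angle [t] of its difference from
    [x]. In these coordinates the domain [0 < r] is convex, so that angles lift, although the space
    of pairs of distinct points is not simply connected. *)
Definition extends_angle (f : R2 -> R2) (Psi : R2 -> R -> R -> R) : Prop :=
  continuous_on (fun p : R2 * (R * R) => 0 < fst (snd p))
    (fun p : R2 * (R * R) => Psi (fst p) (fst (snd p)) (snd (snd p))) /\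
  (forall x r t, 0 < r ->
    isangle (vsub (f (vadd x (vscal r (dir t)))) (f x)) (Psi x r t)).

Lemma continuous_on_Psi (f : R2 -> R2) Psi {U : UniformSpace} (D : U -> Prop)
    (a : U -> R2) (b c : U -> R) :
  extends_angle f Psi ->
  continuous_on D a -> continuous_on D b -> continuous_on D c ->
  (forall x, D x -> 0 < b x) -> continuous_on D (fun x => Psi (a x) (b x) (c x)).
Proof.
  intros [H _] Ha Hb Hc Hpos.
  apply (continuous_on_comp D (fun p : R2 * (R * R) => 0 < fst (snd p))
    (fun x => (a x, (b x, c x))) (fun p : R2 * (R * R) => Psi (fst p) (fst (snd p)) (snd (snd p)))); auto.
  cts.
Qed.

Lemma extends_angle_exists (f : R2 -> R2) :
  (forall x, continuous f x) -> (forall x y, f x = f y -> x = y) ->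
  exists Psi, extends_angle f Psi.
Proof.
  intros Hf Hinj.
  destruct (angle_lift_space
    (fun p : R2 * (R * R) => 0 < fst (snd p))
    (fun p : R2 * (R * R) =>
      vsub (f (vadd (fst p) (vscal (fst (snd p)) (dir (snd (snd p)))))) (f (fst p))))
    as [L [HL1 HL2]].
  - convex; convex_bounds.
  - apply continuous_on_vsub.
    + apply (continuous_on_comp_total _ _ f); auto. cts.
    + apply (continuous_on_comp_total _ _ f); auto. cts.
  - intros [x [r t]] H E. simpl in *. apply vsub_eq0, Hinj in E.
    destruct x as [a b]. unfold vadd, vscal, dir in E; simpl in E. inversion E.
    assert (C := sin2_cos2 t). unfold Rsqr in C. nra.
  - exists (fun x r t => L (x, (r, t))). split.
    + apply (continuous_on_ext _ L); auto. now intros [x [r t]] _.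
    + intros x r t Hr. exact (HL2 (x, (r, t)) Hr).
Qed.

Lemma vadd_dir_neq x r t : 0 < r -> vadd x (vscal r (dir t)) <> x.
Proof.
  intros Hr E. destruct x as [a b]. unfold vadd, vscal, dir in E; simpl in E. inversion E.
  assert (C := sin2_cos2 t). unfold Rsqr in C. nra.
Qed.

(** On the convex domain the increment under a full turn is a constant multiple of [2 * PI];
    preservation of orientation on the unit circle about the origin shows that it is exactly one
    turn. *)
Lemma extends_angle_2pi (f : R2 -> R2) Psi :
  (forall x, continuous f x) -> (forall x y, f x = f y -> x = y) ->
  orientation_preserving f -> extends_angle f Psi ->
  forall x r t, 0 < r -> Psi x r (t + 2 * PI) = Psi x r t + 2 * PI.
Proof.
  intros Hf Hinj Hop HPsi.
  assert (Hnz : forall x r t, 0 < r -> vsub (f (vadd x (vscal r (dir t)))) (f x) <> (0, 0)).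
  { intros x r t Hr E. apply vsub_eq0, Hinj in E. now apply vadd_dir_neq in E. }
  destruct (lift_diff_const_space
    (fun p : R2 * (R * R) => 0 < fst (snd p))
    (fun p : R2 * (R * R) => Psi (fst p) (fst (snd p)) (snd (snd p) + 2 * PI))
    (fun p : R2 * (R * R) => Psi (fst p) (fst (snd p)) (snd (snd p)))) as [k Hk].
  - convex; convex_bounds.
  - apply (continuous_on_Psi f); auto; cts.
  - apply (continuous_on_Psi f); auto; cts.
  - intros [x [r t]] Hr; simpl in *.
    apply (isangle_unique (vsub (f (vadd x (vscal r (dir t)))) (f x))); auto.
    + replace (dir t) with (dir (t + 2 * PI)).
      * apply HPsi; auto.
      * unfold dir. rewrite cos_plus, sin_plus, cos_2PI, sin_2PI. f_equal; ring.
    + apply HPsi; auto.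
  - destruct (Hop (0, 0) 1 Rlt_0_1) as [th [Hth [Hang Hinc]]].
    destruct (lift_diff_const (V := R_NormedModule) (fun t => 0 <= t <= 1)
      (fun t => Psi (0, 0) 1 (2 * PI * t)) th) as [j Hj].
    + convex; convex_bounds.
    + apply (continuous_on_Psi f Psi _ (fun _ => (0, 0)) (fun _ => 1) (fun t => 2 * PI * t));
        auto; cts. intros; lra.
    + apply continuous_on_of_continuous. intros t. apply continuity_pt_filterlim, Hth.
    + intros t Ht. apply (isangle_unique (vsub (f (circle (0, 0) 1 t)) (f (0, 0)))).
      * apply (Hnz (0, 0) 1). lra.
      * apply (proj2 HPsi (0, 0) 1 (2 * PI * t)). lra.
      * exact (Hang t Ht).
    + assert (E0 := Hj 0 ltac:(lra)). assert (E1 := Hj 1 ltac:(lra)).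
      assert (E := Hk ((0, 0), (1, 0))). simpl in E. specialize (E Rlt_0_1).
      simpl in E0, E1.
      rewrite Rmult_0_r in E0. rewrite Rmult_1_r in E1. rewrite Rplus_0_l in E.
      intros x r t Hr. specialize (Hk (x, (r, t)) Hr). simpl in Hk. rewrite Hk. lra.
Qed.

Lemma extends_angle_period (Psi : R2 -> R -> R -> R) :
  (forall x r t, 0 < r -> Psi x r (t + 2 * PI) = Psi x r t + 2 * PI) ->
  forall x r t (k : Z), 0 < r -> Psi x r (t + 2 * PI * IZR k) = Psi x r t + 2 * PI * IZR k.
Proof.
  intros H x r t k Hr. revert k. apply Z.peano_ind.
  - now rewrite Rmult_0_r, !Rplus_0_r.
  - intros k IH. unfold Z.succ. rewrite plus_IZR.
    replace (t + 2 * PI * (IZR k + 1)) with (t + 2 * PI * IZR k + 2 * PI) by ring.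
    rewrite H, IH by auto. ring.
  - intros k IH. unfold Z.pred. rewrite plus_IZR.
    assert (E := H x r (t + 2 * PI * (IZR k + -1)) Hr).
    replace (t + 2 * PI * (IZR k + -1) + 2 * PI) with (t + 2 * PI * IZR k) in E by ring.
    lra.
Qed.

(* Exchanging the two end points of a vector turns it by [PI]; applying this twice is a full
   turn, so the image vector is also turned by exactly [PI]. *)
Lemma extends_angle_swap (f : R2 -> R2) Psi :
  (forall x, continuous f x) -> (forall x y, f x = f y -> x = y) ->
  orientation_preserving f -> extends_angle f Psi ->
  forall x r t, 0 < r -> Psi (vadd x (vscal r (dir t))) r (t + PI) = Psi x r t + PI.
Proof.
  intros Hf Hinj Hop HPsi.
  assert (H2 := extends_angle_2pi f Psi Hf Hinj Hop HPsi).
  assert (Hback : forall x r t, vadd (vadd x (vscal r (dir t))) (vscal r (dir (t + PI))) = x).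
  { intros [a b] r t. unfold vadd, vscal, dir; simpl. rewrite neg_cos, neg_sin. f_equal; ring. }
  destruct (lift_diff_const_space
    (fun p : R2 * (R * R) => 0 < fst (snd p))
    (fun p : R2 * (R * R) =>
      Psi (vadd (fst p) (vscal (fst (snd p)) (dir (snd (snd p))))) (fst (snd p)) (snd (snd p) + PI))
    (fun p : R2 * (R * R) => Psi (fst p) (fst (snd p)) (snd (snd p)) + PI)) as [k Hk].
  - convex; convex_bounds.
  - apply (continuous_on_Psi f); auto; cts.
  - apply continuous_on_Rplus; [|cts]. apply (continuous_on_Psi f); auto; cts.
  - intros [x [r t]] Hr; simpl in *.
    set (y := vadd x (vscal r (dir t))).
    apply (isangle_unique (vsub (f x) (f y))).
    + intros E. apply vsub_eq0, Hinj in E. symmetry in E. now apply vadd_dir_neq in E.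
    + assert (A := proj2 HPsi y r (t + PI) Hr). unfold y in A at 1. rewrite Hback in A. exact A.
    + assert (A := isangle_opp _ _ (proj2 HPsi x r t Hr)). fold y in A.
      replace (vscal (-1) (vsub (f y) (f x))) with (vsub (f x) (f y)) in A; auto.
      unfold vscal, vsub; simpl; f_equal; ring.
  - assert (K : forall x r t, 0 < r ->
      Psi (vadd x (vscal r (dir t))) r (t + PI) = Psi x r t + PI + 2 * PI * IZR k).
    { intros x r t Hr. exact (Hk (x, (r, t)) Hr). }
    assert (Hk0 : 2 * PI * IZR k = 0).
    { assert (A := K (0, 0) 1 0 Rlt_0_1).
      assert (B := K (vadd (0, 0) (vscal 1 (dir 0))) 1 (0 + PI) Rlt_0_1).
      rewrite Hback in B.
      replace (0 + PI + PI) with (0 + 2 * PI) in B by ring.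
      rewrite H2 in B by lra. lra. }
    intros x r t Hr. rewrite K by auto. lra.
Qed.

Lemma vadd_isangle x y t : isangle (vsub y x) t ->
  vadd x (vscal (norm2 (vsub y x)) (dir t)) = y.
Proof.
  intros H. rewrite <- (isangle_vscal _ _ H).
  destruct x, y; unfold vadd, vsub; simpl; f_equal; ring.
Qed.

Lemma vsub_opp x y : vsub x y = vscal (-1) (vsub y x).
Proof. unfold vsub, vscal; simpl; f_equal; ring. Qed.

Lemma extends_angle_image (f : R2 -> R2) Psi x y t : extends_angle f Psi -> x <> y ->
  isangle (vsub y x) t -> isangle (vsub (f y) (f x)) (Psi x (norm2 (vsub y x)) t).
Proof.
  intros [_ H] Hxy Ht.
  assert (Hn : 0 < norm2 (vsub y x)) by (apply norm2_gt0, vsub_neq0; auto).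
  specialize (H x _ t Hn). now rewrite (vadd_isangle _ _ _ Ht) in H.
Qed.

(* In the proof, [al], [B] and [C] are the angles of the chords [c t - c s], [gam s - c r] and
   [f (gam s) - gam s'].  Computing [Th (c p) - Th (c M)] from [C] along the sides of the square
   uses [B] twice, and in both cases [gam] carries the chord [c M - c r] to the reverse of
   [c r - c p]; the two half turns add up to the odd multiple of [2 * PI]. *)
Lemma no_closing (f : R2 -> R2) (c gam : R -> R2) (p M : R) :
  (forall x, continuous f x) -> (forall x y, f x = f y -> x = y) ->
  orientation_preserving f -> (forall x, f x <> x) ->
  (forall t, continuous c t) -> (forall t, continuous gam t) ->
  2 <= M -> 0 <= p -> p + 1 < M ->
  (forall t, 0 <= t <= M - 1 -> c (t + 1) = f (c t)) ->
  (forall s t, 0 <= s -> s < t -> t <= M -> t - s < M -> c s <> c t) ->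
  gam 0 = c M -> gam 1 = c p ->
  (forall s r, 0 <= s <= 1 -> p < r < M -> gam s <> c r) ->
  (forall s s', 0 <= s <= 1 -> 0 <= s' <= 1 -> f (gam s) <> gam s') -> False.
Proof.
  intros Hf Hinj Hop Hfree Hc Hgam HM Hp HpM Hstep Hsimple Hg0 Hg1 Hgc Hgfree.
  destruct (extends_angle_exists f Hf Hinj) as [Psi HPsi].
  assert (P2 := extends_angle_swap f Psi Hf Hinj Hop HPsi).
  assert (P1 := extends_angle_period Psi (extends_angle_2pi f Psi Hf Hinj Hop HPsi)).
  assert (Cf : forall (U : UniformSpace) (D : U -> Prop) (g : U -> R2), continuous_on D g ->
    continuous_on D (fun x => f (g x))).
  { intros U D g Hg; apply (continuous_on_comp_total D g f); auto. }
  assert (Cc : forall (U : UniformSpace) (D : U -> Prop) (g : U -> R), continuous_on D g ->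
    continuous_on D (fun x => c (g x))).
  { intros U D g Hg; apply (continuous_on_comp_total D g c); auto. }
  assert (Cg : forall (U : UniformSpace) (D : U -> Prop) (g : U -> R), continuous_on D g ->
    continuous_on D (fun x => gam (g x))).
  { intros U D g Hg; apply (continuous_on_comp_total D g gam); auto. }
  destruct (angle_lift_plane
    (fun _ : R2 => True) (fun x : R2 => vsub (f x) x)) as [Th [HTh ATh]].
  { now intros. } { cts. now apply Cf; cts. } { intros y _. now apply vsub_neq0. }
  assert (ATh' : forall x, isangle (vsub (f x) x) (Th x)) by (intros; now apply ATh). clear ATh.
  assert (CTh : forall (U : UniformSpace) (D : U -> Prop) (g : U -> R2), continuous_on D g ->
    continuous_on D (fun x => Th (g x))).
  { intros U D g Hg. apply (continuous_on_comp D (fun _ : R2 => True) g Th); auto. }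
  (* The corner [(0, M)] is left out because the end [c M] of the arc is allowed to coincide with
     its start [c 0]. *)
  set (T := fun st : R * R => 0 <= fst st /\ fst st < snd st /\ snd st <= M /\ snd st - fst st < M).
  assert (HT : convex_set (V := planeNM) T).
  { intros [s t] [s' t'] l [A [B [C E]]] [A' [B' [C' E']]] Hl. unfold T in *. simpl in *.
    unfold minus, plus, scal, opp; simpl. unfold mult; simpl.
    split; [|split; [|split]].
    - now apply convex_gec.
    - now apply convex_lt.
    - now apply convex_lec.
    - assert (Q := convex_ltc M (t - s) (t' - s') l E E' Hl). lra. }
  destruct (angle_lift_plane T
    (fun st : R * R => vsub (c (snd st)) (c (fst st)))) as [al [Hal Aal]].
  { exact HT. } { apply continuous_on_vsub; apply Cc; cts. }
  { intros [s t] [A [B [C E]]]; simpl in *. now apply vsub_neq0, not_eq_sym, Hsimple. }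
  assert (Aal' : forall s t, T (s, t) -> isangle (vsub (c t) (c s)) (al (s, t))).
  { intros s t Hst. exact (Aal (s, t) Hst). }
  assert (Hcne : forall s t, T (s, t) -> c s <> c t).
  { intros s t [A [B [C E]]]; simpl in *; now apply Hsimple. }
  assert (Cal : forall (U : UniformSpace) (D : U -> Prop) (g : U -> R * R), continuous_on D g ->
    (forall x, D x -> T (g x)) -> continuous_on D (fun x => al (g x))).
  { intros U D g Hg HD. apply (continuous_on_comp D T g al); auto. }
  set (DB := fun rs : R * R => (p < fst rs < M) /\ 0 <= snd rs <= 1).
  destruct (angle_lift_plane DB
    (fun rs : R * R => vsub (gam (snd rs)) (c (fst rs)))) as [B [HB AB]].
  { intros [r s] [r' s'] l [[A1 A2] [A3 A4]] [[B1 B2] [B3 B4]] Hl. unfold DB in *. simpl in *.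
    unfold minus, plus, scal, opp; simpl. unfold mult; simpl.
    repeat split; [apply convex_gtc | apply convex_ltc | apply convex_gec | apply convex_lec]; auto. }
  { apply continuous_on_vsub; [apply Cg | apply Cc]; cts. }
  { intros [r s] [A1 A2]; simpl in *. apply vsub_neq0. now apply Hgc. }
  assert (AB' : forall r s, DB (r, s) -> isangle (vsub (gam s) (c r)) (B (r, s))).
  { intros r s H. exact (AB (r, s) H). }
  assert (CB : forall (U : UniformSpace) (D : U -> Prop) (g : U -> R * R), continuous_on D g ->
    (forall x, D x -> DB (g x)) -> continuous_on D (fun x => B (g x))).
  { intros U D g Hg HD. apply (continuous_on_comp D DB g B); auto. }
  set (DC := fun ss : R * R => (0 <= fst ss <= 1) /\ 0 <= snd ss <= 1).
  destruct (angle_lift_plane DC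
    (fun ss : R * R => vsub (f (gam (fst ss))) (gam (snd ss)))) as [C [HC AC]].
  { intros [r s] [r' s'] l [[A1 A2] [A3 A4]] [[B1 B2] [B3 B4]] Hl. unfold DC in *. simpl in *.
    unfold minus, plus, scal, opp; simpl. unfold mult; simpl.
    repeat split; [apply convex_gec | apply convex_lec | apply convex_gec | apply convex_lec]; auto. }
  { apply continuous_on_vsub; [apply Cf, Cg | apply Cg]; cts. }
  { intros [r s] [A1 A2]; simpl in *. apply vsub_neq0. now apply Hgfree. }
  assert (AC' : forall s s', DC (s, s') -> isangle (vsub (f (gam s)) (gam s')) (C (s, s'))).
  { intros r s H. exact (AC (r, s) H). }
  assert (CC : forall (U : UniformSpace) (D : U -> Prop) (g : U -> R * R), continuous_on D g ->
    (forall x, D x -> DC (g x)) -> continuous_on D (fun x => C (g x))).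
  { intros U D g Hg HD. apply (continuous_on_comp D DC g C); auto. }
  assert (Hnpos : forall x y : R2, x <> y -> 0 < norm2 (vsub y x)).
  { intros x y H. apply norm2_gt0, vsub_neq0; auto. }
  assert (Iconv : convex_set (V := R_NormedModule) (fun s => 0 <= s <= 1)).
  { convex; convex_bounds. }
  (* From here on the angles are compared two at a time; each comparison yields one unknown
     integer. *)
  destruct (lift_diff_const_plane (fun _ : R2 => True)
    (fun x : R2 => Th (f x)) (fun x : R2 => Psi x (norm2 (vsub (f x) x)) (Th x))) as [k' Hk'].
  { now intros. } { apply CTh, Cf; cts. }
  { apply (continuous_on_Psi f); auto. cts. cts. apply Cf; cts. }
  { intros x _. apply (isangle_unique (vsub (f (f x)) (f x))); auto.
    - now apply vsub_neq0.
    - apply extends_angle_image; auto. }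
  destruct (lift_diff_const_plane
    (fun st : R * R => 0 <= fst st /\ fst st < snd st /\ snd st <= M - 1)
    (fun st : R * R => al (fst st + 1, snd st + 1))
    (fun st : R * R => Psi (c (fst st)) (norm2 (vsub (c (snd st)) (c (fst st)))) (al st))) as [k Hk].
  { intros [s t] [s' t'] l [A1 [A2 A3]] [A4 [A5 A6]] Hl. simpl in *.
    unfold minus, plus, scal, opp; simpl. unfold mult; simpl.
    repeat split; [apply convex_gec | apply convex_lt | apply convex_lec]; auto. }
  { apply Cal; [cts|]. intros [s t] [A1 [A2 A3]]; unfold T; simpl in *; lra. }
  { apply (continuous_on_Psi f); auto.
    - apply Cc; cts.
    - apply continuous_on_norm2, continuous_on_vsub; apply Cc; cts.
    - apply Cal; [cts|]. intros [s t] [A1 [A2 A3]]; unfold T; simpl in *; lra.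
    - intros [s t] [A1 [A2 A3]]; simpl in *. apply Hnpos, Hcne. unfold T; simpl; lra. }
  { intros [s t] [A1 [A2 A3]]; simpl in *.
    apply (isangle_unique (vsub (c (t + 1)) (c (s + 1)))).
    - apply vsub_neq0. intros Q; symmetry in Q; revert Q. apply Hcne. unfold T; simpl; lra.
    - apply Aal'. unfold T; simpl; lra.
    - rewrite !Hstep by lra. apply extends_angle_image; auto.
      + apply Hcne. unfold T; simpl; lra.
      + apply Aal'. unfold T; simpl; lra. }
  destruct (lift_diff_const (V := R_NormedModule) (fun t => 0 <= t <= M - 1)
    (fun t => al (t, t + 1)) (fun t => Th (c t))) as [j Hj].
  { convex; convex_bounds. }
  { apply Cal; [cts|]. intros t Ht; unfold T; simpl in *; lra. }
  { apply CTh, Cc; cts. }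
  { intros t Ht. apply (isangle_unique (vsub (c (t + 1)) (c t))).
    - apply vsub_neq0. rewrite Hstep by lra. apply Hfree.
    - apply Aal'. unfold T; simpl; lra.
    - rewrite Hstep by lra. apply ATh'. }
  destruct (lift_diff_const (V := R_NormedModule) (fun r => p < r < M)
    (fun r => B (r, 0)) (fun r => al (r, M))) as [b Hb].
  { convex; convex_bounds. }
  { apply CB; [cts|]. intros t Ht; unfold DB; simpl in *; lra. }
  { apply Cal; [cts|]. intros t Ht; unfold T; simpl in *; lra. }
  { intros r Hr. apply (isangle_unique (vsub (c M) (c r))).
    - apply vsub_neq0. intros Q; symmetry in Q; revert Q. apply Hcne. unfold T; simpl; lra.
    - rewrite <- Hg0. apply AB'. unfold DB; simpl; lra.
    - apply Aal'. unfold T; simpl; lra. }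
  destruct (lift_diff_const (V := R_NormedModule) (fun r => p < r < M)
    (fun r => B (r, 1)) (fun r => al (p, r) + PI)) as [m Hm].
  { convex; convex_bounds. }
  { apply CB; [cts|]. intros t Ht; unfold DB; simpl in *; lra. }
  { apply continuous_on_Rplus; [|cts]. apply Cal; [cts|]. intros t Ht; unfold T; simpl in *; lra. }
  { intros r Hr. apply (isangle_unique (vsub (c p) (c r))).
    - apply vsub_neq0. apply Hcne. unfold T; simpl; lra.
    - rewrite <- Hg1. apply AB'. unfold DB; simpl; lra.
    - rewrite vsub_opp. apply isangle_opp. apply Aal'. unfold T; simpl; lra. }
  destruct (lift_diff_const (V := R_NormedModule) (fun s => 0 <= s <= 1)
    (fun s => Th (gam s)) (fun s => C (s, s))) as [i Hi]; auto.
  { apply CTh, Cg; cts. }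
  { apply CC; [cts|]. intros s Hs; unfold DC; simpl in *; lra. }
  { intros s Hs. apply (isangle_unique (vsub (f (gam s)) (gam s))); auto.
    - now apply vsub_neq0.
    - apply AC'. unfold DC; simpl; lra. }
  assert (HM1 : c M = f (c (M - 1))).
  { rewrite <- Hstep by lra. f_equal; ring. }
  destruct (lift_diff_const (V := R_NormedModule) (fun s => 0 <= s <= 1)
    (fun s => Psi (c (M - 1)) (norm2 (vsub (gam s) (c (M - 1)))) (B (M - 1, s)))
    (fun s => C (s, 0))) as [i2 Hi2]; auto.
  { apply (continuous_on_Psi f); auto.
    - cts.
    - apply continuous_on_norm2, continuous_on_vsub; [apply Cg|]; cts.
    - apply CB; [cts|]. intros s Hs; unfold DB; simpl in *; lra.
    - intros s Hs. apply Hnpos. apply not_eq_sym. apply Hgc; lra. }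
  { apply CC; [cts|]. intros s Hs; unfold DC; simpl in *; lra. }
  { intros s Hs. apply (isangle_unique (vsub (f (gam s)) (gam 0))).
    - apply vsub_neq0. apply Hgfree; lra.
    - rewrite Hg0, HM1. apply extends_angle_image; auto.
      + apply not_eq_sym. apply Hgc; lra.
      + apply AB'. unfold DB; simpl; lra.
    - apply AC'. unfold DC; simpl; lra. }
  destruct (lift_diff_const (V := R_NormedModule) (fun s => 0 <= s <= 1)
    (fun s => B (p + 1, s)) (fun s => C (1, s) + PI)) as [i3 Hi3]; auto.
  { apply CB; [cts|]. intros s Hs; unfold DB; simpl in *; lra. }
  { apply continuous_on_Rplus; [|cts]. apply CC; [cts|]. intros s Hs; unfold DC; simpl in *; lra. }
  { intros s Hs. apply (isangle_unique (vsub (gam s) (f (gam 1)))).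
    - apply vsub_neq0, not_eq_sym. apply Hgfree; lra.
    - rewrite Hg1, <- Hstep by lra. apply AB'. unfold DB; simpl; lra.
    - rewrite vsub_opp. apply isangle_opp, AC'. unfold DC; simpl; lra. }
  simpl in *.
  (* For chords from [c t] to [c (t + 1)] the angles [al] and [Th] differ by the same integer [j] at
     [t = 0] and [t = 1], so the two comparisons with [Psi] have the same integer. *)
  assert (Ekk : k = k').
  { assert (E1 := Hk (0, 1)). simpl in E1. specialize (E1 ltac:(lra)).
    assert (E2 := Hj 0 ltac:(lra)). assert (E3 := Hj 1 ltac:(lra)).
    assert (E4 := Hk' (c 0) I). rewrite <- Hstep in E4 by lra.
    rewrite !Rplus_0_l in *. replace (1 + 1) with 2 in * by ring.
    rewrite E2, P1 in E1 by (apply Hnpos, Hcne; unfold T; simpl; lra).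
    assert (Q := PI_RGT_0).
    apply eq_IZR. apply Rmult_eq_reg_l with (2 * PI); lra. }
  subst k'.
  (* Evaluating the comparisons at [s = 0] and [s = 1], and at [r = p + 1] and [r = M - 1], makes
     all integers except [b] and [m] cancel. *)
  set (u := c (M - 1)) in *. set (v := c p) in *. set (w := c M) in *.
  assert (Ek := Hk (p, M - 1)). simpl in Ek. specialize (Ek ltac:(lra)).
  replace (M - 1 + 1) with M in Ek by ring. fold u v in Ek.
  assert (Ejv := Hj p ltac:(lra)). fold v in Ejv.
  assert (Eju := Hj (M - 1) ltac:(lra)). replace (M - 1 + 1) with M in Eju by ring. fold u in Eju.
  assert (Eb1 := Hb (p + 1) ltac:(lra)). assert (Eb2 := Hb (M - 1) ltac:(lra)).
  assert (Em1 := Hm (p + 1) ltac:(lra)). assert (Em2 := Hm (M - 1) ltac:(lra)).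
  assert (Ei0 := Hi 0 ltac:(lra)). assert (Ei1 := Hi 1 ltac:(lra)).
  assert (E20 := Hi2 0 ltac:(lra)). assert (E21 := Hi2 1 ltac:(lra)).
  assert (E30 := Hi3 0 ltac:(lra)). assert (E31 := Hi3 1 ltac:(lra)).
  rewrite Hg0 in Ei0, E20. rewrite Hg1 in Ei1, E21.
  assert (Eu := Hk' u I). rewrite <- HM1 in Eu.
  assert (Huw : u <> w) by (rewrite HM1; apply not_eq_sym, Hfree).
  assert (Huv : v <> u) by (apply Hcne; unfold T; simpl; lra).
  rewrite Eb2, Eju in E20.
  replace (Th u + 2 * PI * IZR j + 2 * PI * IZR b) with (Th u + 2 * PI * IZR (j + b)) in E20
    by (rewrite plus_IZR; ring).
  rewrite P1, plus_IZR in E20 by auto.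
  assert (Hr := Hnpos v u Huv).
  (* The chord between [v] and [u] is seen from both ends; exchanging them costs half a turn, which
     [Psi] preserves. *)
  assert (Hs := P2 v _ (al (p, M - 1)) Hr).
  rewrite vadd_isangle in Hs by (apply Aal'; unfold T; simpl; lra).
  assert (En : norm2 (vsub v u) = norm2 (vsub u v)) by (rewrite vsub_opp; apply norm2_opp).
  rewrite Em2, P1, En, Hs in E21 by (rewrite En; exact Hr).
  assert (Hfin : 2 * PI * (1 + 2 * IZR m - 2 * IZR b) = 0) by lra.
  assert (Q := PI_RGT_0).
  assert (Z : IZR (1 + 2 * m - 2 * b) = 0).
  { rewrite minus_IZR, plus_IZR, !mult_IZR. apply Rmult_eq_reg_l with (2 * PI); lra. }
  apply eq_IZR in Z. lia.
Qed.

(** * Returns to a free disc *)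

Lemma inv_INR_small e : 0 < e -> exists N, forall n, (N <= n)%nat -> / (INR n + 1) < e.
Proof.
  intros He. destruct (archimed_cor1 e He) as [N [HN HN0]]. exists N. intros n Hn.
  apply Rle_lt_trans with (2 := HN). apply le_INR in Hn.
  apply Rinv_le_contravar; [now apply lt_0_INR | lra].
Qed.

Lemma ValAdh_near u l e N : ValAdh u l -> 0 < e -> exists n, (N <= n)%nat /\ Rabs (u n - l) < e.
Proof.
  intros H He. apply (H (fun x => Rabs (x - l) < e) N).
  exists (mkposreal e He). unfold included, disc. auto.
Qed.

(** Bolzano-Weierstrass is used twice: [phi] selects terms whose first coordinates converge to [l],
    and a cluster value of the second coordinates is taken along [phi]. *)
Lemma bounded_cluster (u : nat -> R2) (A : R) : (forall n, norm2 (u n) <= A) ->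
  exists y, forall e N, 0 < e -> exists n, (N <= n)%nat /\ dist2 (u n) y < e.
Proof.
  intros HA.
  assert (H1 : forall n, - A <= fst (u n) <= A).
  { intros n. apply Rabs_le_between. eapply Rle_trans; [apply fst_le_norm2 | apply HA]. }
  assert (H2 : forall n, - A <= snd (u n) <= A).
  { intros n. apply Rabs_le_between. eapply Rle_trans; [apply snd_le_norm2 | apply HA]. }
  destruct (Bolzano_Weierstrass (fun n => fst (u n)) _ (compact_P3 (- A) A) H1) as [l Hl].
  assert (Hphi : forall k, exists n, (k <= n)%nat /\ Rabs (fst (u n) - l) < / (INR k + 1)).
  { intros k. apply (ValAdh_near (fun n => fst (u n))); auto.
    apply Rinv_0_lt_compat. assert (P := pos_INR k). lra. }
  apply choice in Hphi. destruct Hphi as [phi Hphi].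
  destruct (Bolzano_Weierstrass (fun k => snd (u (phi k))) _ (compact_P3 (- A) A)
    (fun k => H2 (phi k))) as [l' Hl'].
  exists (l, l'). intros e N He.
  destruct (inv_INR_small (e / 2)) as [N' HN']; [lra|].
  destruct (ValAdh_near _ _ (e / 2) (N + N') Hl') as [k [Hk Hk']]; [lra|].
  destruct (Hphi k) as [Hp Hp']. exists (phi k). split; [lia|].
  rewrite dist2_norm2. eapply Rle_lt_trans; [apply norm2_le_sum|]. unfold vsub; simpl.
  specialize (HN' k ltac:(lia)). lra.
Qed.

(** The lower bound [dist2 x z] keeps a minimizing sequence bounded; by continuity a cluster point
    of it attains the infimum [- L]. *)
Lemma coercive_min (m : R2 -> R) (z : R2) : contR m -> (forall x, dist2 x z <= m x) ->
  exists a, forall x, m a <= m x.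
Proof.
  intros Hm Hz.
  destruct (completeness (fun y => exists x, y = - m x)) as [L [HL1 HL2]].
  { exists 0. intros y [x ->]. assert (H := Hz x). assert (H' := dist2_ge0 x z). lra. }
  { exists (- m z). now exists z. }
  assert (Hu : forall n, exists x, m x < - L + / (INR n + 1)).
  { intros n. apply NNPP. intros Hno.
    assert (P : 0 < / (INR n + 1)) by (apply Rinv_0_lt_compat; assert (Q := pos_INR n); lra).
    assert (L <= L - / (INR n + 1)); [|lra].
    apply HL2. intros y [x ->]. apply not_ex_all_not with (n := x) in Hno. lra. }
  apply choice in Hu. destruct Hu as [u Hu].
  destruct (bounded_cluster u (- L + 1 + norm2 z)) as [a Ha].
  { intros n. assert (A := Hz (u n)). specialize (Hu n).
    assert (/ (INR n + 1) <= 1).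
    { rewrite <- Rinv_1. apply Rinv_le_contravar; [lra|]. assert (Q := pos_INR n). lra. }
    assert (T := norm2_triang (vsub (u n) z) z).
    replace (vadd (vsub (u n) z) z) with (u n) in T
      by (destruct (u n), z; unfold vadd, vsub; simpl; f_equal; ring).
    rewrite dist2_norm2 in A. lra. }
  exists a.
  assert (HaL : m a <= - L).
  { apply Rnot_lt_le. intros Hlt. set (e := (m a + L) / 2).
    assert (He : 0 < e) by (unfold e; lra).
    destruct (Hm a e He) as [d [Hd Hda]].
    destruct (inv_INR_small e He) as [N HN].
    destruct (Ha d N Hd) as [n [Hn Hna]]. specialize (Hda _ Hna). specialize (HN n Hn).
    specialize (Hu n). apply Rabs_def2 in Hda. unfold e in *. lra. }
  intros x. assert (- m x <= L) by (apply HL1; now exists x). lra.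
Qed.

Lemma push_inside x z r d : dist2 x z = r -> 0 < r -> 0 < d ->
  exists x', dist2 x' x < d /\ dist2 x' z < r.
Proof.
  (* A step by the fraction [s] towards [z] moves the point by [s * r], which is at most [d / 2]. *)
  intros Hx Hr Hd. set (s := Rmin (1 / 2) (d / (2 * r))).
  assert (Hq : 0 < d / (2 * r)) by (apply Rdiv_lt_0_compat; lra).
  assert (Hs : 0 < s <= 1 / 2).
  { split; [apply Rmin_glb_lt; lra | apply Rmin_l]. }
  assert (Hs2 : s <= d / (2 * r)) by apply Rmin_r.
  exists (vadd x (vscal s (vsub z x))).
  assert (E1 : dist2 (vadd x (vscal s (vsub z x))) x = s * r).
  { rewrite dist2_norm2. replace (vsub _ x) with (vscal (- s) (vsub x z)).
    - rewrite norm2_vscal, Rabs_Ropp, Rabs_pos_eq by lra. now rewrite <- Hx, dist2_norm2.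
    - unfold vscal, vadd, vsub; simpl; f_equal; ring. }
  assert (E2 : dist2 (vadd x (vscal s (vsub z x))) z = (1 - s) * r).
  { rewrite dist2_norm2. replace (vsub _ z) with (vscal (1 - s) (vsub x z)).
    - rewrite norm2_vscal, Rabs_pos_eq by lra. now rewrite <- Hx, dist2_norm2.
    - unfold vscal, vadd, vsub; simpl; f_equal; ring. }
  rewrite E1, E2. split; [|nra].
  apply Rle_lt_trans with (d / (2 * r) * r); [apply Rmult_le_compat_r; lra|].
  replace (d / (2 * r) * r) with (d / 2) by (field; lra). lra.
Qed.

Lemma dist2_contR (f : R2 -> R2) z : cont2 f -> contR (fun x => dist2 (f x) z).
Proof.
  intros Hf x e He. destruct (Hf x e He) as [d [Hd Hdf]]. exists d; split; auto.
  intros y Hy. specialize (Hdf y Hy).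
  assert (A := dist2_triang (f y) (f x) z). assert (B := dist2_triang (f x) (f y) z).
  rewrite (dist2_sym (f x) (f y)) in B. apply Rabs_def1; lra.
Qed.

Lemma Rmax_contR u v : contR u -> contR v -> contR (fun x => Rmax (u x) (v x)).
Proof.
  intros Hu Hv x e He. destruct (Hu x e He) as [d [Hd A]]. destruct (Hv x e He) as [d' [Hd' B]].
  exists (Rmin d d'). split; [now apply Rmin_glb_lt|]. intros y Hy.
  assert (Hy1 : dist2 y x < d) by (eapply Rlt_le_trans; [exact Hy | apply Rmin_l]).
  assert (Hy2 : dist2 y x < d') by (eapply Rlt_le_trans; [exact Hy | apply Rmin_r]).
  specialize (A y Hy1). specialize (B y Hy2).
  apply Rabs_def2 in A. apply Rabs_def2 in B.
  unfold Rmax; repeat destruct Rle_dec; apply Rabs_def1; lra.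
Qed.

(* [B(z, r)] is the largest open disc about [z] that is disjoint from its image; by maximality
   its closure contains some point [a] together with [f a]. *)
Lemma maximal_free_disc (f g : R2 -> R2) z : homeo_with_inv f g -> (forall x, f x <> x) ->
  exists r a, 0 < r /\ dist2 a z = r /\ dist2 (f a) z = r /\
    (forall x, dist2 x z < r -> r < dist2 (f x) z) /\
    (forall x, dist2 x z <= r -> r <= dist2 (f x) z).
Proof.
  intros [Hf [Hg [Hgf Hfg]]] Hfree.
  (* [m x] is the radius of the smallest closed disc about [z] that contains both [x] and [f x]; its
     minimum is the radius at which the growing disc first meets its image. *)
  set (m := fun x => Rmax (dist2 x z) (dist2 (f x) z)).
  destruct (coercive_min m z) as [a Ha].
  { apply Rmax_contR; [|now apply dist2_contR]. apply (dist2_contR (fun x => x)).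
    intros x e He; now exists e. }
  { intros x; apply Rmax_l. }
  set (r := m a).
  assert (Hr : 0 < r).
  { assert (A := dist2_ge0 a z). assert (A1 := Rmax_l (dist2 a z) (dist2 (f a) z)).
    assert (A2 := Rmax_r (dist2 a z) (dist2 (f a) z)). fold (m a) in A1, A2. fold r in A1, A2.
    destruct (Rle_lt_or_eq_dec 0 r) as [|E]; [lra | assumption |].
    assert (B := dist2_ge0 (f a) z).
    elim (Hfree a). transitivity z; [|symmetry]; apply dist2_eq0; lra. }
  assert (F0 : forall x, dist2 x z < r -> r <= dist2 (f x) z).
  { intros x Hx. assert (H := Ha x). fold r in H. unfold m, Rmax in H. destruct Rle_dec in H; lra. }
  assert (F1 : forall x, dist2 x z < r -> r < dist2 (f x) z).
  (* If [f x] lay on the circle, a nearby point inside the disc would have its preimage still in the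
     open disc, against [F0]. *)
  { intros x Hx. destruct (F0 x Hx) as [|E]; auto. exfalso.
    destruct (Hg (f x) (r - dist2 x z)) as [d [Hd Hdg]]; [lra|].
    destruct (push_inside (f x) z r d) as [y [Hy1 Hy2]]; auto.
    specialize (Hdg y Hy1). rewrite Hgf in Hdg.
    assert (T := dist2_triang (g y) x z).
    assert (Q := F0 (g y)). rewrite Hfg in Q. lra. }
  assert (F2 : forall x, dist2 x z <= r -> r <= dist2 (f x) z).
  { intros x [Hx|Hx]; auto. apply Rnot_lt_le. intros Hlt.
    destruct (Hf x (r - dist2 (f x) z)) as [d [Hd Hdf]]; [lra|].
    destruct (push_inside x z r d) as [y [Hy1 Hy2]]; auto.
    specialize (Hdf y Hy1). assert (T := dist2_triang (f y) (f x) z).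
    assert (Q := F0 y Hy2). lra. }
  assert (A1 := Rmax_l (dist2 a z) (dist2 (f a) z)).
  assert (A2 := Rmax_r (dist2 a z) (dist2 (f a) z)). fold (m a) in A1, A2. fold r in A1, A2.
  assert (E : dist2 a z = r).
  { destruct A1 as [A1|A1]; auto. apply F1 in A1. lra. }
  exists r, a. repeat split; auto.
  assert (Q := F2 a). lra.
Qed.

(** * Curves invariant under the map and their first return to a disc *)

Lemma first_hit (h : R -> R) s0 s1 r : (forall t, continuous h t) -> s0 <= s1 ->
  r < h s0 -> h s1 <= r ->
  exists M, s0 <= M <= s1 /\ h M = r /\ forall t, s0 <= t < M -> r < h t.
Proof.
  intros Hh H01 H0 H1.
  assert (Hloc : forall t e, 0 < e -> exists d, 0 < d /\
    forall u, Rabs (u - t) < d -> Rabs (h u - h t) < e).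
  { intros t e He. destruct (Hh t _ (locally_ball (h t) (mkposreal e He))) as [d Hd].
    exists d; split; [apply cond_pos|]. exact Hd. }
  (* [M] is the supremum of the times up to which [h] stays above [r]. Were [h M] below [r],
     slightly earlier values would be too; were it above, [M] could be increased. *)
  destruct (completeness (fun t => s0 <= t <= s1 /\ forall u, s0 <= u <= t -> r < h u)) as [M [HM1 HM2]].
  { exists s1. now intros t [[_ H] _]. }
  { exists s0. split; [lra|]. intros u Hu. now replace u with s0 by lra. }
  assert (HsM : s0 <= M).
  { apply HM1. split; [lra|]. intros u Hu. now replace u with s0 by lra. }
  assert (HMs : M <= s1) by (apply HM2; now intros t [[_ H] _]).
  assert (Hbelow : forall t, s0 <= t < M -> r < h t).
  { intros t Ht. apply NNPP. intros Hno. assert (M <= t); [|lra].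
    apply HM2. intros u [Hu1 Hu2]. apply Rnot_lt_le. intros Hlt. apply Hno, Hu2. lra. }
  exists M. split; [lra|]. split; auto.
  destruct (Rtotal_order (h M) r) as [Hlt|[E|Hgt]]; auto; exfalso.
  - destruct (Hloc M (r - h M)) as [d [Hd Hdh]]; [lra|].
    assert (HsM' : s0 < M) by (destruct HsM as [|E]; auto; subst; lra).
    set (t := Rmax s0 (M - d / 2)).
    assert (Ht : s0 <= t < M /\ M - d / 2 <= t).
    { unfold t, Rmax; destruct Rle_dec; lra. }
    assert (Q := Hbelow t (proj1 Ht)).
    assert (Q' : Rabs (h t - h M) < r - h M) by (apply Hdh, Rabs_def1; lra).
    apply Rabs_def2 in Q'. lra.
  - destruct (Hloc M (h M - r)) as [d [Hd Hdh]]; [lra|].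
    assert (HMs' : M < s1) by (destruct HMs as [|E]; auto; subst; lra).
    set (t := Rmin s1 (M + d / 2)).
    assert (Ht : M < t <= s1 /\ t <= M + d / 2).
    { unfold t, Rmin; destruct Rle_dec; lra. }
    assert (t <= M); [|lra].
    apply HM1. split; [lra|]. intros u Hu. destruct (Rlt_le_dec u M) as [|Hu']; [apply Hbelow; lra|].
    assert (Q' : Rabs (h u - h M) < h M - r) by (apply Hdh, Rabs_def1; lra).
    apply Rabs_def2 in Q'. lra.
Qed.

Lemma lipschitz_continuous (u : R -> R) :
  (forall x y, Rabs (u y - u x) <= Rabs (y - x)) -> forall x, continuous u x.
Proof.
  intros H x P [e He]. exists e. intros y Hy. apply He.
  eapply Rle_lt_trans; [apply (H x y) | exact Hy].
Qed.

Lemma continuous_Rmin_r b x : continuous (fun t => Rmin t b) x.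
Proof.
  apply (lipschitz_continuous (fun t => Rmin t b)). intros s t.
  unfold Rmin, Rabs. repeat destruct Rle_dec; repeat destruct Rcase_abs; lra.
Qed.

Lemma continuous_Rmax_r b x : continuous (fun t => Rmax t b) x.
Proof.
  apply (lipschitz_continuous (fun t => Rmax t b)). intros s t.
  unfold Rmax, Rabs. repeat destruct Rle_dec; repeat destruct Rcase_abs; lra.
Qed.

Lemma orbit_curve (f : R2 -> R2) (c0 : R -> R2) (N : nat) :
  (forall x, continuous f x) -> (forall t, continuous c0 t) -> c0 1 = f (c0 0) ->
  exists c : R -> R2, (forall t, continuous c t) /\ (forall t, 0 <= t <= 1 -> c t = c0 t) /\
    (forall t, 0 <= t <= INR N -> c (t + 1) = f (c t)).
Proof.
  intros Hf H0 H01. induction N as [|N [c [Hc [Hc0 Hstep]]]].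
  - exists c0. repeat split; auto. simpl. intros t Ht. replace t with 0 by lra. now rewrite Rplus_0_l.
  (* One formula covers both pieces: up to time [1] the last two terms cancel, and afterwards the
     first and the last do. *)
  - set (c' := fun t => vadd (c0 (Rmin t 1)) (vsub (f (c (Rmax t 1 - 1))) (c0 1))).
    assert (E1 : forall t, 0 <= t <= 1 -> c' t = c0 t).
    { intros t Ht. unfold c'. rewrite Rmin_left, Rmax_right by lra. replace (1 - 1) with 0 by ring.
      rewrite (Hc0 0), <- H01 by lra. destruct (c0 t), (c0 1); unfold vadd, vsub; simpl; f_equal; ring. }
    assert (E2 : forall t, 1 <= t -> c' t = f (c (t - 1))).
    { intros t Ht. unfold c'. rewrite Rmin_right, Rmax_left by lra.
      destruct (f (c (t - 1))), (c0 1); unfold vadd, vsub; simpl; f_equal; ring. }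
    exists c'. split; [|split]; auto.
    + intros t. apply (continuous_continuous_on (fun _ : R => True)); [now exists (mkposreal 1 Rlt_0_1)|].
      assert (C : continuous_on (fun _ : R => True) c'); [|exact C].
      apply continuous_on_vadd; [|apply continuous_on_vsub; [|cts]].
      * apply (continuous_on_comp_total _ (fun t => Rmin t 1) c0); auto.
        apply continuous_on_of_continuous. intros; apply continuous_Rmin_r.
      * apply (continuous_on_comp_total _ (fun t => c (Rmax t 1 - 1)) f); auto.
        apply (continuous_on_comp_total _ (fun t => Rmax t 1 - 1) c); auto.
        apply continuous_on_Rminus; [|cts].
        apply continuous_on_of_continuous. intros; apply continuous_Rmax_r.
    + rewrite S_INR. intros t Ht. rewrite E2 by lra. f_equal.
      replace (t + 1 - 1) with t by ring.
      destruct (Rle_lt_dec t 1).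
      * rewrite E1, Hc0 by lra; auto.
      * rewrite E2, <- Hstep by lra. f_equal; ring.
Qed.

Lemma continuous_of_on (U : UniformSpace) (h : R -> U) :
  continuous_on (fun _ : R => True) h -> forall t, continuous h t.
Proof.
  intros H t. apply (continuous_continuous_on (fun _ : R => True)); auto.
  now exists (mkposreal 1 Rlt_0_1).
Qed.

(* Radially from [a] at time [0] to [z] at time [1/2], then radially to [b] at time [1]. *)
Definition two_radii (a z b : R2) (t : R) : R2 :=
  vadd z (vadd (vscal (Rmax (1 - 2 * t) 0) (vsub a z)) (vscal (Rmax (2 * t - 1) 0) (vsub b z))).

Lemma two_radii_l a z b t : t <= 1 / 2 -> two_radii a z b t = vadd z (vscal (1 - 2 * t) (vsub a z)).
Proof.
  intros H. unfold two_radii. rewrite Rmax_left, Rmax_right by lra.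
  unfold vadd, vscal; simpl; f_equal; ring.
Qed.

Lemma two_radii_r a z b t : 1 / 2 <= t -> two_radii a z b t = vadd z (vscal (2 * t - 1) (vsub b z)).
Proof.
  intros H. unfold two_radii. rewrite Rmax_right, Rmax_left by lra.
  unfold vadd, vscal; simpl; f_equal; ring.
Qed.

Lemma continuous_two_radii a z b t : continuous (two_radii a z b) t.
Proof.
  apply continuous_of_on. unfold two_radii.
  cts; (apply (continuous_on_comp_total _ _ (fun x => Rmax x 0));
    [cts | intros; apply continuous_Rmax_r]).
Qed.

Lemma dist2_vadd_vscal z l v : dist2 (vadd z (vscal l v)) z = Rabs l * norm2 v.
Proof.
  rewrite dist2_norm2, <- norm2_vscal. f_equal. unfold vadd, vsub, vscal; simpl; f_equal; ring.
Qed.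

Lemma dist2_two_radii a z b r t : dist2 a z = r -> dist2 b z = r ->
  dist2 (two_radii a z b t) z = Rabs (1 - 2 * t) * r.
Proof.
  intros Ha Hb. rewrite dist2_norm2 in Ha, Hb. destruct (Rle_lt_dec t (1 / 2)).
  - rewrite two_radii_l, dist2_vadd_vscal, Ha; auto.
  - rewrite two_radii_r, dist2_vadd_vscal, Hb by lra.
    replace (1 - 2 * t) with (- (2 * t - 1)) by ring. now rewrite Rabs_Ropp.
Qed.

Lemma radial_inj z l u v : 0 < l ->
  vadd z (vscal l (vsub u z)) = vadd z (vscal l (vsub v z)) -> u = v.
Proof.
  intros Hl E. destruct z, u, v; unfold vadd, vscal, vsub in E; simpl in E. inversion E. f_equal; nra.
Qed.

(** Equal distances to [z] leave only two times symmetric about [1 / 2]; the points are then on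
    different radii at the same positive distance, and coincidence would give [a = b]. *)
Lemma two_radii_inj a z b r s t : 0 < r -> dist2 a z = r -> dist2 b z = r -> a <> b ->
  0 <= s -> s < t -> t <= 1 -> two_radii a z b s <> two_radii a z b t.
Proof.
  intros Hr Ha Hb Hab Hs Hst Ht E.
  assert (Es := dist2_two_radii a z b r s Ha Hb). assert (Et := dist2_two_radii a z b r t Ha Hb).
  rewrite E, Et in Es. apply Rmult_eq_reg_r in Es; [|lra].
  assert (Hsum : t = 1 - s /\ s < 1 / 2).
  { revert Es. unfold Rabs. repeat destruct Rcase_abs; lra. }
  destruct Hsum as [-> Hs2].
  rewrite two_radii_l, two_radii_r in E by lra.
  replace (2 * (1 - s) - 1) with (1 - 2 * s) in E by ring.
  apply radial_inj in E; auto. lra.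
Qed.

(* The curve [c] through [a], [z], [f a] and their iterates first comes back to the closed disc
   at [c M], and is closed up by the radius from [c M] to [z]. *)
Lemma no_return (f g : R2 -> R2) z r a n :
  homeo_with_inv f g -> orientation_preserving f -> (forall x, f x <> x) ->
  0 < r -> dist2 a z = r -> dist2 (f a) z = r ->
  (forall x, dist2 x z < r -> r < dist2 (f x) z) ->
  (forall x, dist2 x z <= r -> r <= dist2 (f x) z) ->
  (1 <= n)%nat -> dist2 (Nat.iter n f z) z < r -> False.
Proof.
  intros [Hf [Hg [Hgf Hfg]]] Hop Hfree Hr Ha Hb F1 F2 Hn Hret.
  assert (Hinj : forall x y, f x = f y -> x = y).
  { intros x y E. rewrite <- (Hgf x), <- (Hgf y). now rewrite E. }
  assert (Hf' := cont2_continuous f Hf).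
  set (b := f a) in *. set (c0 := two_radii a z b).
  assert (Hab : a <> b) by (apply not_eq_sym, Hfree).
  destruct (orbit_curve f c0 (S n) Hf') as [c [Hc [Hc0 Hstep]]].
  { intros; apply continuous_two_radii. }
  { unfold c0. rewrite (two_radii_r _ _ _ 1), (two_radii_l _ _ _ 0) by lra.
    replace (vadd z (vscal (1 - 2 * 0) (vsub a z))) with a
      by (destruct a, z; unfold vadd, vsub, vscal; simpl; f_equal; ring).
    fold b. destruct b, z; unfold vadd, vsub, vscal; simpl; f_equal; ring. }
  assert (Hcz : c (1 / 2) = z).
  { rewrite Hc0 by lra. unfold c0. rewrite two_radii_l by lra.
    destruct a, z; unfold vadd, vsub, vscal; simpl; f_equal; field. }
  assert (Hcb : c 1 = b).
  { rewrite Hc0 by lra. unfold c0. rewrite two_radii_r by lra.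
    destruct b, z; unfold vadd, vsub, vscal; simpl; f_equal; ring. }
  assert (Hcn : forall k, (k <= n)%nat -> c (INR k + 1 / 2) = Nat.iter k f z).
  { induction k as [|k IH]; intros Hk.
    - simpl. now rewrite Rplus_0_l.
    - rewrite S_INR. replace (INR k + 1 + 1 / 2) with (INR k + 1 / 2 + 1) by ring.
      rewrite Hstep, IH; [reflexivity | lia |].
      rewrite S_INR. apply le_INR in Hk. rewrite S_INR in Hk. assert (P := pos_INR k). lra. }
  set (h := fun t => dist2 (c t) z).
  assert (Hh : forall t, continuous h t).
  { apply continuous_of_on. unfold h.
    change (continuous_on (fun _ : R => True) (fun t => norm2 (vsub (c t) z))).
    apply continuous_on_norm2, continuous_on_vsub; [|cts]. now apply continuous_on_of_continuous. }
  assert (Hh0 : forall t, 0 <= t <= 1 -> h t = Rabs (1 - 2 * t) * r).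
  { intros t Ht. unfold h. rewrite Hc0 by auto. now apply dist2_two_radii. }
  assert (Hn1 : 1 <= INR n) by (apply (le_INR 1); exact Hn).
  (* For these times [c (t - 1)] lies in the open disc, whose image stays outside the closed
     disc. *)
  assert (Hh12 : forall t, 1 < t < 2 -> r < h t).
  { intros t Ht. unfold h. replace t with (t - 1 + 1) by ring.
    rewrite Hstep by (rewrite S_INR; lra). apply F1. change (h (t - 1) < r). rewrite Hh0 by lra.
    assert (Rabs (1 - 2 * (t - 1)) < 1) by (apply Rabs_def1; lra). nra. }
  (* At time [3 / 2] the curve is outside; at time [INR n + 1 / 2] it is at the [n]-th iterate of
     [z], back inside. *)
  destruct (first_hit h (3 / 2) (INR n + 1 / 2) r Hh) as [M [HM1 [HM2 HM3]]].
  { lra. } { apply Hh12; lra. } { unfold h. rewrite Hcn by lia. lra. }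
  assert (HM : 2 <= M).
  { apply Rnot_lt_le. intros H. assert (Q := Hh12 M). lra. }
  assert (Hout : forall t, 1 < t < M -> r < h t).
  { intros t Ht. destruct (Rlt_le_dec t 2); [apply Hh12 | apply HM3]; lra. }
  assert (Hin : forall s, 0 <= s <= 1 -> h s <= r).
  { intros s Hs. rewrite Hh0 by auto. assert (Rabs (1 - 2 * s) <= 1) by (apply Rabs_le; lra). nra. }
  (* Induction on a bound for [s]: injectivity of [f] pulls a coincidence back in time until
     [s < 1]. Then [c s] is in the closed disc, where the curve returns only at time [M], on the
     circle; as [0 < s] in that case, [c s] is strictly inside. *)
  assert (Hsimple : forall (k : nat) s t, s < INR k + 1 ->
    0 <= s -> s < t -> t <= M -> t - s < M -> c s <> c t).
  { induction k as [|k IH]; intros s t Hsk Hs Hst Ht Hts E.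
    - simpl in Hsk.
      assert (Es : h s = h t) by (unfold h; now rewrite E).
      destruct (Rle_lt_dec t 1) as [Ht1|Ht1].
      { rewrite !Hc0 in E by lra. revert E. apply (two_radii_inj a z b r); auto. }
      assert (Q := Hin s ltac:(lra)).
      destruct Ht as [Ht|Ht]; [assert (Q' := Hout t); lra|]. subst t.
      rewrite HM2, Hh0 in Es by lra.
      assert (0 < s) by lra.
      assert (Rabs (1 - 2 * s) < 1) by (apply Rabs_def1; lra). nra.
    - destruct (Rlt_le_dec s 1) as [Hs1|Hs1].
      { apply (IH s t); auto. assert (P := pos_INR k). lra. }
      rewrite S_INR in Hsk.
      apply (IH (s - 1) (t - 1)); try lra.
      apply Hinj. rewrite <- !Hstep by (rewrite S_INR; lra).
      now replace (s - 1 + 1) with s by ring; replace (t - 1 + 1) with t by ring. }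
  assert (Hsimple' : forall s t, 0 <= s -> s < t -> t <= M -> t - s < M -> c s <> c t).
  { intros s t Hs Hst Ht Hts. apply (Hsimple (S n)); auto. rewrite S_INR. lra. }
  clear Hsimple.
  assert (HcM : c M <> b).
  { rewrite <- Hcb. apply not_eq_sym. apply Hsimple'; lra. }
  set (gam := fun s => vadd z (vscal (1 - s) (vsub (c M) z))).
  assert (Hgd : forall s, 0 <= s <= 1 -> dist2 (gam s) z = (1 - s) * r).
  { intros s Hs. unfold gam. rewrite dist2_vadd_vscal, <- dist2_norm2, Rabs_pos_eq by lra.
    fold (h M). now rewrite HM2. }
  assert (Hg0 : gam 0 = c M).
  { unfold gam. destruct (c M), z; unfold vadd, vsub, vscal; simpl; f_equal; ring. }
  (* The closing radius ends at [z], which the arc passes at time [1 / 2]. *)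
  apply (no_closing f c gam (1 / 2) M); auto; try lra.
  - apply continuous_of_on. unfold gam. cts.
  - intros t Ht. apply Hstep. rewrite S_INR. lra.
  - rewrite Hcz. unfold gam. destruct (c M), z; unfold vadd, vsub, vscal; simpl; f_equal; ring.
  - intros s t Hs Ht E.
    assert (Eh : (1 - s) * r = h t) by (rewrite <- Hgd by auto; unfold h; now rewrite E).
    (* A common point of the radii to [c M] and to [b] other than [z] would identify these two
       ends. *)
    destruct (Rle_lt_dec t 1) as [Ht1|Ht1].
    + rewrite Hh0 in Eh by lra. apply Rmult_eq_reg_r in Eh; [|lra].
      rewrite <- Rabs_Ropp, Rabs_pos_eq in Eh by lra.
      rewrite Hc0 in E by lra. unfold c0 in E. rewrite two_radii_r in E by lra.
      replace (2 * t - 1) with (1 - s) in E by lra.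
      apply HcM, (radial_inj z (1 - s)); auto. lra.
    + assert (Q := Hout t). nra.
  - intros s s' Hs Hs' E.
    assert (E' := Hgd s Hs). assert (E'' := Hgd s' Hs'). rewrite <- E in E''.
    (* For [0 < s] the point is in the open disc and its image is outside the closed one. The end
       [gam 0 = c M] could only be mapped to itself, which is excluded. *)
    destruct (Rle_lt_or_eq_dec 0 s) as [Hs0|Hs0]; [lra| |].
    + assert (Q := F1 (gam s)). nra.
    + subst s. assert (Q := F2 (gam 0)).
      assert (s' = 0) by nra. subst s'. now apply Hfree in E.
Qed.

(** [no_return] requires the centre of the disc itself to come back. So the free disc of radius [r]
    about the cluster point [y] is exchanged for one about an orbit point: within [r / 3] of [y]
    such a disc has radius at least [2 * r / 3] and contains the whole open disc of radius [r / 3]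
    about [y]. The alternative in the last hypothesis admits both forward and backward orbits. *)
Lemma orbit_no_cluster (f g : R2 -> R2) (u : nat -> R2) A :
  homeo_with_inv f g -> orientation_preserving f -> (forall x, f x <> x) ->
  (forall n, norm2 (u n) <= A) ->
  (forall i j, (i < j)%nat -> exists k, (1 <= k)%nat /\
    (Nat.iter k f (u i) = u j \/ Nat.iter k f (u j) = u i)) -> False.
Proof.
  intros Hfg Hop Hfree HA Hu.
  destruct (bounded_cluster u A HA) as [y Hy].
  destruct (maximal_free_disc f g y Hfg Hfree) as [r [a [Hr [Ha1 [Ha2 [F1 F2]]]]]].
  assert (Hz : forall z n, (1 <= n)%nat -> dist2 z y < r / 3 ->
    dist2 (Nat.iter n f z) y < r / 3 -> False).
  { intros z n Hn Hzy Hny.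
    destruct (maximal_free_disc f g z Hfg Hfree) as [r' [a' [Hr' [Ha1' [Ha2' [F1' F2']]]]]].
    apply (no_return f g z r' a' n); auto.
    assert (2 * r / 3 <= r').
    { apply Rnot_lt_le. intros Hlt.
      assert (T1 := dist2_triang a' z y). assert (Q := F1 a').
      assert (T2 := dist2_triang (f a') z y). lra. }
    assert (T := dist2_triang (Nat.iter n f z) y z). rewrite (dist2_sym y z) in T. lra. }
  destruct (Hy (r / 3) 0%nat) as [i [_ Hi]]; [lra|].
  destruct (Hy (r / 3) (S i)) as [j [Hij Hj]]; [lra|].
  destruct (Hu i j Hij) as [k [Hk [E|E]]].
  - apply (Hz (u i) k); auto. now rewrite E.
  - apply (Hz (u j) k); auto. now rewrite E.
Qed.

Lemma iter_cancel (f g : R2 -> R2) : (forall x, f (g x) = x) ->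
  forall n x, Nat.iter n f (Nat.iter n g x) = x.
Proof.
  intros H n. induction n as [|n IH]; intros x; auto.
  rewrite Nat.iter_succ_r. rewrite (Nat.iter_succ n _ g), H. apply IH.
Qed.

Lemma orbit_unbounded_fwd (f g : R2 -> R2) x A :
  homeo_with_inv f g -> orientation_preserving f -> (forall x, f x <> x) ->
  exists n, A < norm2 (Nat.iter n f x).
Proof.
  intros Hfg Hop Hfree. apply NNPP. intros Hno.
  apply (orbit_no_cluster f g (fun n => Nat.iter n f x) A); auto.
  - intros n. apply Rnot_lt_le. intros H. apply Hno. now exists n.
  - intros i j Hij. exists (j - i)%nat. split; [lia|]. left.
    rewrite <- Nat.iter_add. f_equal. lia.
Qed.

Lemma orbit_unbounded_bwd (f g : R2 -> R2) x A :
  homeo_with_inv f g -> orientation_preserving f -> (forall x, f x <> x) ->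
  exists n, A < norm2 (Nat.iter n g x).
Proof.
  intros Hfg Hop Hfree. apply NNPP. intros Hno.
  apply (orbit_no_cluster f g (fun n => Nat.iter n g x) A); auto.
  - intros n. apply Rnot_lt_le. intros H. apply Hno. now exists n.
  - intros i j Hij. exists (j - i)%nat. split; [lia|]. right.
    replace (Nat.iter j g x) with (Nat.iter (j - i) g (Nat.iter i g x))
      by (rewrite <- Nat.iter_add; f_equal; lia).
    apply iter_cancel, Hfg.
Qed.

(** * Shadowing *)

Lemma finite_lower_bound (h : nat -> R) : (forall i, 0 < h i) ->
  forall n, exists e, 0 < e <= 1 /\ forall i, (i <= n)%nat -> e <= h i.
Proof.
  intros H n. induction n as [|n [e [He Hi]]].
  - exists (Rmin 1 (h 0%nat)). split.
    + split; [apply Rmin_glb_lt; auto; lra | apply Rmin_l].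
    + intros i Hi. replace i with 0%nat by lia. apply Rmin_r.
  - exists (Rmin e (h (S n))). split.
    + split; [apply Rmin_glb_lt; auto; lra|]. apply Rle_trans with e; [apply Rmin_l | lra].
    + intros i Hin. destruct (Nat.eq_dec i (S n)) as [->|]; [apply Rmin_r|].
      apply Rle_trans with e; [apply Rmin_l|]. apply Hi. lia.
Qed.

(* The minimum over [i < N] of the functions equal to [1] before [i] and to [e i] after [i + 1],
   affine in between. *)
Fixpoint ramp (e : nat -> R) (N : nat) (r : R) : R :=
  match N with
  | O => 1
  | S i => Rmin (ramp e i r) (1 + (e i - 1) * clamp (r - INR i))
  end.

Lemma clamp_lipschitz x y : Rabs (clamp x - clamp y) <= Rabs (x - y).
Proof.
  unfold clamp, Rmax, Rmin, Rabs. repeat destruct Rle_dec; repeat destruct Rcase_abs; lra.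
Qed.

Lemma ramp_lipschitz e N : (forall i, 0 < e i <= 1) ->
  forall r r', Rabs (ramp e N r - ramp e N r') <= Rabs (r - r').
Proof.
  intros He r r'. induction N as [|N IH]; simpl.
  - rewrite Rminus_diag, Rabs_R0. apply Rabs_pos.
  - assert (H : Rabs (1 + (e N - 1) * clamp (r - INR N) - (1 + (e N - 1) * clamp (r' - INR N)))
                <= Rabs (r - r')).
    { replace (_ - _) with ((e N - 1) * (clamp (r - INR N) - clamp (r' - INR N))) by ring.
      rewrite Rabs_mult. assert (A := clamp_lipschitz (r - INR N) (r' - INR N)).
      replace (r - INR N - (r' - INR N)) with (r - r') in A by ring.
      assert (B : Rabs (e N - 1) <= 1) by (specialize (He N); apply Rabs_le; lra).
      assert (C := Rabs_pos (e N - 1)). assert (D := Rabs_pos (clamp (r - INR N) - clamp (r' - INR N))).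
      nra. }
    revert IH H. set (x := ramp e N r). set (y := ramp e N r').
    set (x' := 1 + _). set (y' := 1 + _). intros IH H.
    apply Rabs_le_between in IH. apply Rabs_le_between in H.
    apply Rabs_le. unfold Rmin. repeat destruct Rle_dec; lra.
Qed.

Lemma ramp_pos e N r : (forall i, 0 < e i <= 1) -> 0 < ramp e N r <= 1.
Proof.
  intros He. induction N as [|N IH]; simpl; [lra|].
  assert (C := clamp_range (r - INR N)). specialize (He N).
  split; [apply Rmin_glb_lt; [lra | nra]|].
  eapply Rle_trans; [apply Rmin_l | lra].
Qed.

(** The term of index [i] equals [1] up to radius [i], so on a bounded range of radii the infimum
    over all indices is a finite minimum. *)
Lemma ramp_stable e r N k : (forall i, 0 < e i <= 1) -> r <= INR N -> ramp e (k + N) r = ramp e N r.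
Proof.
  intros He Hr. induction k as [|k IH]; auto. simpl. rewrite IH.
  assert (H : clamp (r - INR (k + N)) = 0).
  { rewrite plus_INR. assert (P := pos_INR k).
    unfold clamp, Rmax, Rmin. repeat destruct Rle_dec; lra. }
  rewrite H. assert (Q := ramp_pos e N r He). apply Rmin_left. lra.
Qed.

Lemma ramp_le e r N i : (i < N)%nat -> INR i + 1 <= r -> ramp e N r <= e i.
Proof.
  intros Hi Hr. induction N as [|N IH]; [lia|]. simpl.
  destruct (Nat.eq_dec i N) as [->|].
  - eapply Rle_trans; [apply Rmin_r|].
    assert (H : clamp (r - INR N) = 1) by (unfold clamp, Rmax, Rmin; repeat destruct Rle_dec; lra).
    rewrite H. lra.
  - eapply Rle_trans; [apply Rmin_l|]. apply IH. lia.
Qed.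

Lemma norm2_lipschitz x y : Rabs (norm2 y - norm2 x) <= dist2 y x.
Proof.
  assert (A := dist2_triang y x (0, 0)). assert (B := dist2_triang x y (0, 0)).
  assert (E : forall v, dist2 v (0, 0) = norm2 v).
  { intros v. rewrite dist2_norm2. f_equal. destruct v; unfold vsub; simpl; f_equal; ring. }
  rewrite !E in *. rewrite (dist2_sym x y) in B. apply Rabs_le. lra.
Qed.

(** The bound on the norms leaves finitely many indices in each disc. Positive lower bounds [e n] of
    [eta k j] for [k] and [j] up to [n] are interpolated by a continuous function of the norm. *)
Lemma small_Cplus (P : nat -> nat -> R2) (eta : nat -> nat -> R) :
  (forall k j, INR (k + j) + 1 <= norm2 (P k j)) -> (forall k j, 0 < eta k j) ->
  exists eps, Cplus eps /\ forall k j, eps (P k j) <= eta k j.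
Proof.
  intros HP Heta.
  assert (He : forall n, exists e, (0 < e <= 1) /\
    forall k j, (k <= n)%nat -> (j <= n)%nat -> e <= eta k j).
  { intros n.
    assert (H : forall k, exists e, (0 < e <= 1) /\ forall j, (j <= n)%nat -> e <= eta k j).
    { intros k. now apply finite_lower_bound. }
    apply choice in H. destruct H as [e1 H1].
    destruct (finite_lower_bound e1 (fun k => proj1 (proj1 (H1 k))) n) as [e [E1 E2]].
    exists e. split; auto. intros k j Hk Hj. apply Rle_trans with (e1 k); auto. now apply H1. }
  apply choice in He. destruct He as [e He].
  assert (He1 : forall i, 0 < e i <= 1) by (intros; apply He).
  assert (HN : forall r, exists N, r <= INR N).
  { intros r. destruct (INR_unbounded r) as [N HN]. exists N. lra. }
  apply choice in HN. destruct HN as [N HN].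
  (* The number of terms depends on [r], but more terms change nothing, so two radii can be compared
     with a common number of terms. *)
  set (E := fun r => ramp e (N r) r).
  assert (HE : forall r M, (N r <= M)%nat -> E r = ramp e M r).
  { intros r M HM. replace M with ((M - N r) + N r)%nat by lia. symmetry. now apply ramp_stable. }
  exists (fun x => E (norm2 x)). split; [split|].
  - intros x d Hd. exists d; split; auto. intros y Hy.
    rewrite (HE (norm2 y) (N (norm2 x) + N (norm2 y))%nat) by lia.
    rewrite (HE (norm2 x) (N (norm2 x) + N (norm2 y))%nat) by lia.
    eapply Rle_lt_trans; [now apply ramp_lipschitz|].
    eapply Rle_lt_trans; [apply norm2_lipschitz | exact Hy].
  - intros x. now apply ramp_pos.
  - intros k j. apply Rle_trans with (e (k + j)%nat).
    + rewrite (HE _ (N (norm2 (P k j)) + S (k + j))%nat) by lia. apply ramp_le; [lia | apply HP].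
    + apply He; lia.
Qed.

Lemma cont2_iter f n : cont2 f -> cont2 (Nat.iter n f).
Proof.
  intros Hf. induction n as [|n IH]; intros x e He.
  - now exists e.
  - destruct (Hf (Nat.iter n f x) e He) as [d [Hd Hdf]].
    destruct (IH x d Hd) as [d' [Hd' Hdf']]. exists d'. split; auto.
    intros y Hy. apply Hdf, Hdf', Hy.
Qed.

Lemma iterZ_nat f g n x : iterZ f g (Z.of_nat n) x = Nat.iter n f x.
Proof. destruct n; auto. simpl. now rewrite SuccNat2Pos.id_succ. Qed.

Lemma iterZ_neg f g n x : iterZ f g (- Z.of_nat n) x = Nat.iter n g x.
Proof. destruct n; auto. simpl. now rewrite SuccNat2Pos.id_succ. Qed.

Lemma iterZ_succ f g n x : (forall x, f (g x) = x) -> f (iterZ f g n x) = iterZ f g (n + 1) x.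
Proof.
  intros H. destruct (Z_lt_le_dec n 0) as [Hn|Hn].
  - replace n with (- Z.of_nat (S (Z.to_nat (- n - 1))))%Z at 1 by lia.
    replace (n + 1)%Z with (- Z.of_nat (Z.to_nat (- n - 1)))%Z by lia.
    rewrite !iterZ_neg. apply H.
  - replace n with (Z.of_nat (Z.to_nat n)) at 1 by lia.
    replace (n + 1)%Z with (Z.of_nat (S (Z.to_nat n))) by lia.
    now rewrite !iterZ_nat.
Qed.

Lemma eq_of_dist2_small x y : (forall j : nat, dist2 x y < / (INR j + 1)) -> x = y.
Proof.
  intros H. apply dist2_eq0. destruct (dist2_ge0 x y) as [Hlt|E]; auto. exfalso.
  destruct (inv_INR_small _ Hlt) as [N HN]. specialize (HN N (Nat.le_refl N)).
  specialize (H N). lra.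
Qed.

Lemma escaping_orbits_not_shadowed (f g : R2 -> R2) : homeo_with_inv f g ->
  (forall x A, exists n, A < norm2 (Nat.iter n f x)) ->
  (forall x A, exists n, A < norm2 (Nat.iter n g x)) ->
  ~ topological_shadowing f g.
Proof.
  intros [Hf [Hg [Hgf Hfg]]] Hfwd Hbwd Hsh.
  set (p := (0, 0) : R2). set (q := fun k : nat => (/ (INR k + 1), 0) : R2).
  (* A time and a tolerance: [k = 0] stands for the backward orbit of [p], [k = i + 1] for the
     forward orbit of [q i]. *)
  assert (HP : forall k j, exists Pe : nat * R, 0 < snd Pe /\
    match k with
    | O => INR (k + j) + 1 <= norm2 (Nat.iter (fst Pe) g p) /\
           forall y, dist2 (Nat.iter (fst Pe) g y) (Nat.iter (fst Pe) g p) < snd Pe ->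
             dist2 y p < / (INR j + 1)
    | S i => INR (k + j) + 1 <= norm2 (Nat.iter (fst Pe) f (q i)) /\
           forall y, dist2 (Nat.iter (fst Pe) f y) (Nat.iter (fst Pe) f (q i)) < snd Pe ->
             dist2 y (q i) < / (INR j + 1)
    end).
  { intros k j.
    assert (Hj : 0 < / (INR j + 1)) by (apply Rinv_0_lt_compat; assert (Q := pos_INR j); lra).
    destruct k as [|i].
    - destruct (Hbwd p (INR (0 + j) + 1)) as [n Hn].
      (* Continuity of the inverse iterate at the far point supplies the tolerance. *)
      destruct (cont2_iter f n Hf (Nat.iter n g p) _ Hj) as [d [Hd H]].
      exists (n, d). simpl fst; simpl snd. split; [exact Hd|]. split; [lra|].
      intros y Hy. apply H in Hy. now rewrite !(iter_cancel f g) in Hy.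
    - destruct (Hfwd (q i) (INR (S i + j) + 1)) as [n Hn].
      destruct (cont2_iter g n Hg (Nat.iter n f (q i)) _ Hj) as [d [Hd H]].
      exists (n, d). simpl fst; simpl snd. split; [exact Hd|]. split; [lra|].
      intros y Hy. apply H in Hy. now rewrite !(iter_cancel g f) in Hy. }
  assert (HP' := fun k => choice _ (HP k)). apply choice in HP'. destruct HP' as [T HT].
  (* A single [eps] has to serve all the [q k], since [k] is chosen only after [delta] is known. *)
  destruct (small_Cplus
    (fun k j => match k with
                | O => Nat.iter (fst (T k j)) g p
                | S i => Nat.iter (fst (T k j)) f (q i)
                end)
    (fun k j => snd (T k j))) as [eps [Heps Hsmall]].
  { intros [|i] j; [apply (HT 0%nat) | apply (HT (S i))]. }
  { intros k j; apply HT. }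
  destruct (Hsh eps Heps) as [delta [[_ Hdelta] Hshad]].
  destruct (inv_INR_small (delta p) (Hdelta p)) as [k Hk]. specialize (Hk k (Nat.le_refl k)).
  assert (Hkpos : 0 < / (INR k + 1)) by (apply Rinv_0_lt_compat; assert (Q := pos_INR k); lra).
  (* The backward half orbit of [p] followed by the forward half orbit of [q k]: the only jump is
     from [f (xs (-1)) = p] to [q k], of length [/ (INR k + 1)]. *)
  set (xs := fun n : Z => iterZ f g n (if Z_lt_dec n 0 then p else q k)).
  destruct (Hshad xs) as [y Hy].
  { intros n. unfold xs at 1 3. rewrite iterZ_succ by auto. unfold xs.
    destruct (Z.eq_dec n (-1)) as [->|Hn].
    - simpl. unfold p, q, dist2; simpl fst; simpl snd.
      replace ((0 - / (INR k + 1)) ^ 2 + (0 - 0) ^ 2) with ((/ (INR k + 1)) ^ 2) by ring.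
      rewrite sqrt_pow2 by lra. exact Hk.
    - destruct (Z_lt_dec n 0), (Z_lt_dec (n + 1) 0); try lia; rewrite dist2_refl; apply Hdelta. }
  assert (Ep : y = p).
  { apply eq_of_dist2_small. intros j. apply (HT 0%nat j).
    eapply Rlt_le_trans; [|exact (Hsmall 0%nat j)].
    specialize (Hy (- Z.of_nat (fst (T 0%nat j)))%Z). unfold xs in Hy. rewrite !iterZ_neg in Hy.
    (* Index [0] carries [q k], not [p], so the selected time must not be [0]; indeed the selected
       point has norm at least [1], whereas [p] is the origin. *)
    destruct Z_lt_dec as [_|Hneg] in Hy; [exact Hy|].
    assert (E0 : fst (T 0%nat j) = 0%nat) by lia.
    destruct (HT 0%nat j) as [_ [Habs _]]. rewrite E0 in Habs. exfalso.
    assert (norm2 p = 0) by (apply norm2_unique; unfold p; simpl; lra).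
    assert (Q := pos_INR (0 + j)). cbn [Nat.iter nat_rect] in Habs. lra. }
  assert (Eq : y = q k).
  { apply eq_of_dist2_small. intros j. apply (HT (S k) j).
    eapply Rlt_le_trans; [|exact (Hsmall (S k) j)].
    specialize (Hy (Z.of_nat (fst (T (S k) j)))). unfold xs in Hy. rewrite !iterZ_nat in Hy.
    destruct Z_lt_dec in Hy; [lia | exact Hy]. }
  rewrite Ep in Eq. unfold p, q in Eq. inversion Eq. lra.
Qed.

Theorem theorem1 (f g : R2 -> R2) :
  homeo_with_inv f g ->
  orientation_preserving f ->
  topological_shadowing f g ->
  exists p : R2, f p = p.
Proof.
  intros Hfg Hop Hsh. apply NNPP. intros Hno.
  assert (Hfree : forall x, f x <> x) by (intros x E; apply Hno; now exists x).
  apply (escaping_orbits_not_shadowed f g Hfg); auto; intros x A.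
  - now apply (orbit_unbounded_fwd f g).
  - now apply (orbit_unbounded_bwd f g).
Qed.
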